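(* Let $n,r\ge 1$ be integers. The map $\psi:G(n,r)\to S_0(n,r)$ of $\mathbb{Z}$-algebras defined on generators by $\psi(e_{i,\underline d})=e_{i,\underline d}$, $\psi(f_{i,\underline d})=f_{i,\underline d}$ and $\psi(k_{\underline d})=k_{\underline d}$ (for all $\underline d$ and $i$ for which these elements are defined) is an isomorphism of $\mathbb{Z}$-algebras.
   Context: Flags and orbits. Let $k$ be a field and $V$ an $r$-dimensional $k$-vector space. $\mathcal{F}$ is the set (variety) of $n$-step flags $f:\{0\}=V_0\subseteq V_1\subseteq\cdots\subseteq V_n=V$. $\mathrm{GL}(V)$ acts on $\mathcal{F}$ and diagonally on $\mathcal{F}\times\mathcal{F}$; $[f,f']$ is the $\mathrm{GL}(V)$-orbit of $(f,f')$. For $f=(V_i)$, $f'=(V'_i)$ put $A(f,f')_{ij}=\dim(V_{i-1}+V_i\cap V'_j)-\dim(V_{i-1}+V_i\cap V'_{j-1})$. This gives a bijection between $\mathrm{GL}(V)$-orbits in $\mathcal{F}\times\mathcal{F}$ and $n\times n$ matrices of non-negative integers with entries summing to $r$; $e_A$ denotes the orbit with matrix $A$. $D(n,r)$ is the set of $n$-tuples $\underline d=(d_1,\dots,d_n)$ of non-negative integers with sum $r$, and $\mathcal{F}_{\underline d}\subseteq\mathcal{F}$ is the set of flags with $\dim V_i-\dim V_{i-1}=d_i$ for all $i$. $0$-Schur algebra. For matrices $A,A',A''$ there is a polynomial $g_{A,A',A''}\in\mathbb{Z}[q]$ such that over every finite field $k$ and any $(f_1,f_2)\in e_{A''}$,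 the value of $g_{A,A',A''}$ at $|k|$ is the number of $f\in\mathcal{F}$ with $(f_1,f)\in e_A$ and $(f,f_2)\in e_{A'}$. $S_q(n,r)$ is the free $\mathbb{Z}[q]$-module with basis the symbols $e_A$ and multiplication $e_Ae_{A'}=\sum_{A''}g_{A,A',A''}e_{A''}$; $S_0(n,r)=S_q(n,r)\otimes_{\mathbb{Z}[q]}\mathbb{Z}[q]/(q)$. Generic algebra. Let $k$ be algebraically closed. For orbits $e_A,e_{A'}$ let $S(A,A')=\{(f_1,f_2): \exists f\in\mathcal{F},\ (f_1,f)\in e_A,\ (f,f_2)\in e_{A'}\}$. If non-empty, $S(A,A')$ contains a unique $\mathrm{GL}(V)$-orbit open in it (Zariski topology). $G(n,r)$ is the free $\mathbb{Z}$-module with basis the orbits $e_A$ and bilinear product $e_A\star e_{A'}$ equal to the open orbit in $S(A,A')$ if $S(A,A')\ne\emptyset$, and $0$ otherwise; it is an associative $\mathbb{Z}$-algebra. Special orbits (viewed as basis elements in either algebra). For $\underline d\in D(n,r)$: $k_{\underline d}=[h,h]$ with $h\in\mathcal{F}_{\underline d}$. For $1\le i\le n-1$ and $d_{i+1}>0$: $e_{i,\underline d}=[f,f']$ where $f'\in\mathcal{F}_{\underline d}$, $f'_j=f_j$ for $j\ne i$, $f'_i\subset f_i$ of codimension $1$ (i.e. the orbit with matrix $\mathrm{diag}(\underline d)-E_{i+1,i+1}+E_{i,i+1}$). For $1\le i\le n-1$ and $d_i>0$: $f_{i,\underline d}=[f',f]$ where $f\in\mathcal{F}_{\underline d}$ and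 $f'_j=f_j$ for $j\neq i$, $f'_i\subset f_i$ of codimension $1$ (matrix $\mathrm{diag}(\underline d)-E_{i,i}+E_{i+1,i}$). These elements generate $G(n,r)$ as a $\mathbb{Z}$-algebra, so an algebra homomorphism is determined by its values on them. *)

(* Defs.v *)
From HB Require Import structures.
From mathcomp Require Import all_boot all_order all_algebra.
From mathcomp Require Import boolp zify.
From mathcomp Require Import mpoly.

Set Implicit Arguments.
Unset Strict Implicit.
Unset Printing Implicit Defensive.

Import GRing.Theory.
Local Open Scope ring_scope.

HB.instance Definition _ (k : finFieldType) (vT : vectType k) :=
  CanIsCountable (@VectorInternalTheory.vs2mxK k vT).
HB.instance Definition _ (k : finFieldType) (vT : vectType k) :
    isFinite {vspace vT} :=
  CanIsFinite (@VectorInternalTheory.vs2mxK k vT).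

(* The step V_{i-1} \subset V_i of the 1-based literature is indexed here by
   i : 'I_n, counted from 0: it goes from [lo i] to [hi i]. *)
Definition lo n (i : 'I_n) : 'I_n.+1 := widen_ord (leqnSn n) i.
Definition hi n (i : 'I_n) : 'I_n.+1 := lift ord0 i.

Section Flags.
Variables (k : fieldType) (n r : nat).

Definition is_flag (f : {ffun 'I_n.+1 -> {vspace 'rV[k]_r}}) : bool :=
  [&& f ord0 == 0%VS, f ord_max == fullv
    & [forall i : 'I_n, (f (lo i) <= f (hi i))%VS]].

Record flag := Flag {
  flag_val :> {ffun 'I_n.+1 -> {vspace 'rV[k]_r}};
  flagP : is_flag flag_val }.

HB.instance Definition _ := [isSub for flag_val].
HB.instance Definition _ := [Choice of flag by <:].

(* The subtraction of natural numbers is exact: the second space is contained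
   in the first. *)
Definition relpos (f f' : flag) : 'M[nat]_n :=
  \matrix_(i, j) (\dim (f (lo i) + (f (hi i) :&: f' (hi j)))%VS
                  - \dim (f (lo i) + (f (hi i) :&: f' (lo j)))%VS)%N.

Definition same_orbit (f f' h h' : flag) : Prop :=
  exists2 g : 'End('rV[k]_r), lker g == 0%VS
    & forall i, (g @: f i = h i)%VS /\ (g @: f' i = h' i)%VS.

Lemma flag0 (f : flag) : f ord0 = 0%VS.
Proof. by case/and3P: (flagP f) => /eqP. Qed.

Lemma flag_max (f : flag) : f ord_max = fullv.
Proof. by case/and3P: (flagP f) => _ /eqP. Qed.

Lemma flag_step (f : flag) i : (f (lo i) <= f (hi i))%VS.
Proof. by case/and3P: (flagP f) => _ _ /forallP. Qed.

Lemma flag_mono (f : flag) (a b : 'I_n.+1) :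
  (a <= b)%N -> (f a <= f b)%VS.
Proof.
case: a b => [a lta] [b ltb] /= leab.
elim: b => [|b IHb] in ltb leab *.
  by case: a leab lta => // _ lta; rewrite (bool_irrelevance lta ltb).
move: leab; rewrite leq_eqVlt => /predU1P[eqab | ltab].
  by case: _ / eqab ltb => ltb; rewrite (bool_irrelevance lta ltb).
apply: subv_trans (IHb (ltnW ltb) ltab) _.
have := flag_step f (Ordinal (ltb : (b < n)%N)).
by congr (f _ <= f _)%VS; apply: val_inj.
Qed.

Lemma sum_step (D : 'I_n.+1 -> nat) :
    {homo D : a b / (a <= b)%N} ->
  (\sum_(i < n) (D (hi i) - D (lo i)) = D ord_max - D ord0)%N.
Proof.
move=> Dmono; pose E m := D (inord m).
have -> : D ord0 = E 0%N by rewrite -[ord0]inord_val.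
have -> : D ord_max = E n by rewrite -[ord_max]inord_val.
rewrite -(@telescope_sumn_in 0 n E) //.
  rewrite big_mkord; apply: eq_bigr => i _; congr (D _ - D _)%N.
    by rewrite -[hi i]inord_val.
  by rewrite -[lo i]inord_val.
move=> i /andP[_ ltin]; apply: Dmono.
by rewrite !inordK ?ltnS // ltnW.
Qed.

Lemma relposE (f f' : flag) i j :
  relpos f f' i j =
  \dim ((f (hi i) :&: f' (hi j))
        :\: (f (lo i) :&: f' (hi j) + f (hi i) :&: f' (lo j)))%VS.
Proof.
have dim_cap b : (\dim (f (lo i) + (f (hi i) :&: f' b))%VS
    + \dim (f (lo i) :&: f' b)%VS
    = \dim (f (lo i)) + \dim (f (hi i) :&: f' b)%VS)%N.
  by rewrite -[RHS]dimv_sum_cap capvA (capv_idPl (flag_step f i)).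
have := dim_cap (hi j); have := dim_cap (lo j).
set X := (f (hi i) :&: f' (hi j))%VS.
set Y1 := (f (lo i) :&: f' (hi j))%VS; set Y2 := (f (hi i) :&: f' (lo j))%VS.
have := dimv_sum_cap Y1 Y2; have := dimv_cap_compl X (Y1 + Y2).
have sY1X : (Y1 <= X)%VS by apply: capvS; rewrite ?flag_step.
have sY2X : (Y2 <= X)%VS by apply: capvS; rewrite ?flag_step.
have /capv_idPr -> : (Y1 + Y2 <= X)%VS by rewrite subv_add sY1X.
have -> : (Y1 :&: Y2 = f (lo i) :&: f' (lo j))%VS.
  rewrite /Y1 /Y2 capvA -(capvA (f (lo i))) (capvC (f' (hi j))) capvA.
  by rewrite (capv_idPl (flag_step f i)) -capvA (capv_idPr (flag_step f' j)).
rewrite mxE -/X -/Y2; lia.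
Qed.

Lemma sum_relpos (f f' : flag) : (\sum_i \sum_j relpos f f' i j)%N = r.
Proof.
transitivity (\sum_(i < n) (\dim (f (hi i)) - \dim (f (lo i))))%N.
  apply: eq_bigr => i _.
  pose D b := \dim (f (lo i) + (f (hi i) :&: f' b))%VS.
  under eq_bigr do rewrite mxE -/(D _) -/(D _).
  rewrite sum_step.
    rewrite /D flag_max flag0 capvf capv0 addv0.
    by rewrite (addv_idPr (flag_step f i)).
  by move=> a b ab; apply/dimvS/addvS/capvS/flag_mono.
rewrite (@sum_step (fun b => \dim (f b))).
  by rewrite flag_max flag0 dimv0 dimvf subn0 /dim /= mul1n.
by move=> a b ab; apply/dimvS/flag_mono.
Qed.

Definition cell (f f' : flag) (p : 'I_n * 'I_n) : {vspace 'rV[k]_r} :=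
  ((f (hi p.1) :&: f' (hi p.2))
     :\: (f (lo p.1) :&: f' (hi p.2) + f (hi p.1) :&: f' (lo p.2)))%VS.

Lemma cap_cells (f f' : flag) (a b : 'I_n.+1) :
  (f a :&: f' b
   = \sum_(p : 'I_n * 'I_n | (p.1 < a)%N && (p.2 < b)%N) cell f f' p)%VS.
Proof.
apply/eqP; rewrite eqEsubv; apply/andP; split; last first.
  apply/subv_sumP => -[i j] /= /andP[ia jb].
  by apply: subv_trans (diffvSl _ _) _; apply: capvS; apply: flag_mono.
have [m] := ubnP (a + b)%N; elim: m a b => // m IHm a b ltm.
have [a0 | a_gt0] := posnP a.
  by rewrite (_ : a = ord0) ?flag0 ?cap0v ?sub0v //; apply: val_inj.
have [b0 | b_gt0] := posnP b.
  by rewrite (_ : b = ord0) ?flag0 ?capv0 ?sub0v //; apply: val_inj.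
have lta : (a.-1 < n)%N by rewrite prednK // -ltnS.
have ltb : (b.-1 < n)%N by rewrite prednK // -ltnS.
pose i := Ordinal lta; pose j := Ordinal ltb.
have Ea : a = hi i by apply: val_inj; rewrite [RHS]lift0 [RHS]prednK.
have Eb : b = hi j by apply: val_inj; rewrite [RHS]lift0 [RHS]prednK.
have sub_IH (a' b' : 'I_n.+1) : (a' <= a)%N -> (b' <= b)%N ->
    (a' + b' < a + b)%N ->
    (f a' :&: f' b'
     <= \sum_(p : 'I_n * 'I_n | (p.1 < a)%N && (p.2 < b)%N) cell f f' p)%VS.
  move=> leaa lebb lt_sum; apply: subv_trans (IHm a' b' _) _; first by lia.
  apply/subv_sumP => p /andP[p1 p2]; apply: sumv_sup (subvv _).
  by rewrite (leq_trans p1) ?(leq_trans p2).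
rewrite -(addv_diff_cap (f a :&: f' b)
  (f (lo i) :&: f' (hi j) + f (hi i) :&: f' (lo j))) subv_add.
apply/andP; split.
  apply: (sumv_sup (i, j)); first by rewrite /= !prednK ?leqnn.
  by rewrite {1}Ea {1}Eb.
apply: subv_trans (capvSr _ _) _; rewrite subv_add -Ea -Eb.
by rewrite !sub_IH //= ?leq_pred //; lia.
Qed.

Lemma cells_full (f f' : flag) : (\sum_p cell f f' p)%VS = fullv.
Proof.
rewrite -[RHS](capvf fullv) -{1}(flag_max f) -(flag_max f') cap_cells.
by apply: eq_bigl => p; rewrite !ltn_ord.
Qed.

Lemma cells_direct (f f' : flag) : directv (\sum_p cell f f' p).
Proof.
rewrite directvEgeq /= cells_full dimvf /dim /= mul1n.
apply: eq_leq; transitivity (\sum_i \sum_j relpos f f' i j)%N.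
  by rewrite pair_big; apply: eq_bigr => p _; rewrite relposE.
exact: sum_relpos.
Qed.

Lemma map_bigcat (T S : Type) (I : eqType) (g : T -> S)
    (A : I -> seq T) (B : I -> seq S) (s : seq I) :
    (forall p, size (A p) = size (B p)) ->
    map g (\big[cat/[::]]_(p <- s) A p) = \big[cat/[::]]_(p <- s) B p ->
  forall p, p \in s -> map g (A p) = B p.
Proof.
move=> sizeAB; elim: s => // q s IHs; rewrite !big_cons map_cat => eqAB p.
have [eq1 eq2] : map g (A q) = B q
    /\ map g (\big[cat/[::]]_(p <- s) A p) = \big[cat/[::]]_(p <- s) B p.
  move: eqAB => /(congr1 (fun t => (take (size (B q)) t, drop (size (B q)) t))).
  by rewrite -{1 2}sizeAB -(size_map g) !take_size_cat ?drop_size_cat ?size_map // => -[].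
by rewrite inE => /predU1P[-> // | /IHs]; apply.
Qed.

(* Two pairs of flags lie in the same GL(V)-orbit if and only if they have the
   same matrix. *)
Lemma same_orbitP (f f' h h' : flag) :
  same_orbit f f' h h' <-> relpos f f' = relpos h h'.
Proof.
split=> [[g g_inj gE] | eq_pos].
  have dim_g U : \dim (g @: U)%VS = \dim U.
    by rewrite limg_dim_eq // (eqP g_inj) capv0.
  apply/matrixP => i j; rewrite !mxE -!(proj1 (gE _)) -!(proj2 (gE _)).
  by rewrite -!lker0_img_cap // -!limgD !dim_g.
pose X p := vbasis (cell f f' p); pose Y p := vbasis (cell h h' p).
have sizeXY p : size (X p) = size (Y p).
  by rewrite !size_tuple /cell -!relposE eq_pos.
have basisX := bigcat_basis (cells_direct f f')
  (fun p _ => vbasisP (cell f f' p)).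
have basisY := bigcat_basis (cells_direct h h')
  (fun p _ => vbasisP (cell h h' p)).
have [g0 g0E] := linear_of_free
  (\big[cat/[::]]_p X p) (\big[cat/[::]]_p Y p).
have gXY p : map g0 (X p) = Y p.
  apply: (map_bigcat sizeXY _ (mem_index_enum p)).
  apply: g0E; first exact: basis_free basisX.
  rewrite !(big_morph _ (@size_cat _) (erefl _)).
  by apply: eq_bigr => q _; rewrite sizeXY.
pose g := linfun g0.
have gcell p : (g @: cell f f' p = cell h h' p)%VS.
  have /andP[/eqP <- _] := vbasisP (cell f f' p).
  have /andP[/eqP <- _] := vbasisP (cell h h' p).
  by rewrite limg_span -/(Y p) -gXY; congr span; apply: eq_map => v; rewrite lfunE.
have gcap a b : (g @: (f a :&: f' b) = h a :&: h' b)%VS.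
  by rewrite !cap_cells limg_sum; apply: eq_bigr.
exists g; last first.
  move=> i; split.
    by have := gcap i ord_max; rewrite !flag_max !capvf.
  by have := gcap ord_max i; rewrite !flag_max !capfv.
have := limg_ker_dim g fullv.
have := gcap ord_max ord_max; rewrite !flag_max !capvf => ->.
by move/eqP; rewrite -[X in _ == X]add0n eqn_add2r capfv dimv_eq0.
Qed.

End Flags.

HB.instance Definition _ (k : finFieldType) n r :=
  [Countable of flag k n r by <:].
HB.instance Definition _ (k : finFieldType) n r :=
  [Finite of flag k n r by <:].

(* n x n matrices of non-negative integers with entries summing to r; the
   bound r on the entries is automatic and makes the type finite. *)
Record posmx (n r : nat) := PosMx {
  posmx_val : 'M['I_r.+1]_n;
  posmxP : (\sum_i \sum_j posmx_val i j)%N == r }.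

HB.instance Definition _ n r := [isSub for @posmx_val n r].
HB.instance Definition _ n r := [Choice of posmx n r by <:].
HB.instance Definition _ n r := [Countable of posmx n r by <:].
HB.instance Definition _ n r := [Finite of posmx n r by <:].

Definition natmx n r (A : posmx n r) : 'M[nat]_n :=
  map_mx (@nat_of_ord _) (posmx_val A).

Lemma natmx_inj n r : injective (@natmx n r).
Proof.
move=> A B /matrixP eqAB; apply/val_inj/matrixP => i j; apply/val_inj.
by have := eqAB i j; rewrite !mxE.
Qed.

Lemma natmx_surj n r (M : 'M[nat]_n) :
  (\sum_i \sum_j M i j)%N = r -> exists A : posmx n r, natmx A = M.
Proof.
move=> sumM.
have leM i j : (M i j < r.+1)%N.
  by rewrite ltnS -sumM (bigD1 i) //= (bigD1 j) //= -addnA leq_addr.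
have AP : (\sum_i \sum_j (\matrix_(i, j) Ordinal (leM i j)) i j)%N == r.
  apply/eqP; rewrite -[RHS]sumM; apply: eq_bigr => i _; apply: eq_bigr => j _.
  by rewrite mxE.
by exists (PosMx AP); apply/matrixP => i j; rewrite !mxE.
Qed.

(* e_A, as a set of pairs of flags; by [same_orbitP] it is one GL(V)-orbit. *)
Definition in_orbit (k : fieldType) n r (A : posmx n r) (f f' : flag k n r) :
  bool := relpos f f' == natmx A.

(* The Zariski topology on the set of pairs of flags. A pair is a point of the
   product, over the spaces of both flags, of copies of the projective space of
   the exterior algebra of V, via Pluecker coordinates. The set of pairs carries
   the topology induced from this product, whose closed sets are the zero loci
   of sets of multihomogeneous polynomials. *)
Section Zariski.
Variables (k : fieldType) (n r : nat).

(* The coordinate with index J of the exterior product of a basis of W in the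
   basis of the exterior algebra indexed by the subsets of 'I_r. It depends on
   the basis only through a scalar factor common to all J. *)
Definition pluecker (W : {vspace 'rV[k]_r}) (J : {set 'I_r}) : k :=
  if #|J| == \dim W
  then \det (\matrix_(a < #|J|, b < #|J|) ((vbasis W)`_a 0 (enum_val b)))
  else 0.

(* (s, i, J) : the J-th coordinate of the i-th space of the first (s = false)
   or second (s = true) flag. *)
Definition coord_index : finType := (bool * 'I_n.+1 * {set 'I_r})%type.

Definition coords (f f' : flag k n r) (x : coord_index) : k :=
  let: (s, i, J) := x in pluecker ((if s then f' else f) i) J.

Definition coord_poly := {mpoly k[#|coord_index|]}.

Definition multihomogeneous (p : coord_poly) : Prop :=
  exists d : bool -> 'I_n.+1 -> nat,
    forall m, m \in msupp p -> forall s i,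
      (\sum_(J : {set 'I_r}) m (enum_rank ((s, i, J) : coord_index)))%N = d s i.

Definition zariski_closed (Z : flag k n r -> flag k n r -> Prop) : Prop :=
  exists P : coord_poly -> Prop,
    (forall p, P p -> multihomogeneous p) /\
    (forall f f', Z f f' <->
       forall p, P p -> p.@[fun x => coords f f' (enum_val x)] = 0).

Definition zariski_open_in (S U : flag k n r -> flag k n r -> Prop) : Prop :=
  exists2 Z, zariski_closed Z & forall f f', U f f' <-> S f f' /\ ~ Z f f'.

End Zariski.

Section Algebras.
Variables (n r : nat).

(* The free R-module with basis the e_A. *)
Definition free_mod (R : comNzRingType) := {ffun posmx n r -> R}.

Definition struct_consts (R : Type) := posmx n r -> posmx n r -> posmx n r -> R.

(* The bilinear product with e_A e_B = \sum_C c A B C e_C. *)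
Definition bilin_mul (R : comNzRingType) (c : struct_consts R)
    (x y : free_mod R) : free_mod R :=
  [ffun C => \sum_A \sum_B x A * y B * c A B C].

Definition is_schur_polynomials (g : struct_consts {poly int}) : Prop :=
  forall (k : finFieldType) (A A' A'' : posmx n r) (f1 f2 : flag k n r),
    in_orbit A'' f1 f2 ->
    (g A A' A'').[#|k|%:R]
    = #|[pred f : flag k n r | in_orbit A f1 f && in_orbit A' f f2]|%:R.

Definition schurq_mul (g : struct_consts {poly int}) :=
  bilin_mul (R := {poly int}) g.

(* Z[q]/(q) is Z, by q |-> 0, so that base change to Z[q]/(q) of the free
   algebra with structure constants g is the free Z-module with the structure
   constants g.[0]; see [schur_red_mul], [schur_red_surj], [schur_red_ker]. *)
Definition schur0_mul (g : struct_consts {poly int}) :=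
  bilin_mul (R := int) (fun A B C => (g A B C).[0]).

Definition schur_red (x : free_mod {poly int}) : free_mod int :=
  [ffun A => (x A).[0]].

Lemma schur_red_mul g x y :
  schur_red (schurq_mul g x y) = schur0_mul g (schur_red x) (schur_red y).
Proof.
apply/ffunP => C; rewrite !ffunE horner_sum; apply: eq_bigr => A _.
by rewrite horner_sum; apply: eq_bigr => B _; rewrite !ffunE !hornerM.
Qed.

Lemma schur_red_surj (y : free_mod int) : exists x, schur_red x = y.
Proof. by exists [ffun A => (y A)%:P]; apply/ffunP => A; rewrite !ffunE hornerC. Qed.

Lemma schur_red_ker (x : free_mod {poly int}) :
  schur_red x = 0 <-> exists y : free_mod {poly int}, x = [ffun A => 'X * y A].
Proof.
split=> [/ffunP x0 | [y ->]]; last first.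
  by apply/ffunP => A; rewrite !ffunE hornerM hornerX mul0r.
exists [ffun A => drop_poly 1 (x A)]; apply/ffunP => A; rewrite !ffunE.
rewrite -[LHS](poly_take_drop 1) expr1 [RHS]mulrC.
suff -> : take_poly 1 (x A) = 0 by rewrite add0r.
apply/polyP => -[|m]; rewrite coef_take_poly coef0 //=.
by have := x0 A; rewrite !ffunE horner_coef0.
Qed.

(* S(A, A') *)
Definition orbit_prod (k : fieldType) (A A' : posmx n r) (f1 f2 : flag k n r) :
  Prop := exists f, in_orbit A f1 f /\ in_orbit A' f f2.

Definition is_open_orbit (k : fieldType) (A A' C : posmx n r) : Prop :=
  zariski_open_in (@orbit_prod k A A') (in_orbit C).

(* There is at most one open orbit, and there is one as soon as S(A, A') is not
   empty, so that [pick ...] does not choose anything. *)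
Definition open_orbit (k : fieldType) (A A' : posmx n r) : option (posmx n r) :=
  [pick C | `[< is_open_orbit k A A' C >]].

Definition generic_mul (k : fieldType) :=
  bilin_mul (R := int) (fun A A' C => (open_orbit k A A' == Some C)%:R).

(* e_M for M with entries summing to r (and 0 for other M). *)
Definition basis_elt (M : 'M[nat]_n) : free_mod int :=
  [ffun A => (natmx A == M)%:R].

Definition diag_nat (d : 'I_n -> nat) : 'M[nat]_n :=
  \matrix_(a, b) (if a == b then d a else 0%N).

(* diag(d) - E_{j,j} + E_{i,j}, for i <> j and d j > 0 *)
Definition move_nat (d : 'I_n -> nat) (i j : 'I_n) : 'M[nat]_n :=
  \matrix_(a, b) (if (a == j) && (b == j) then (d j).-1
                  else if (a == i) && (b == j) then 1%N
                  else diag_nat d a b).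

Definition k_elt (d : 'I_n -> nat) := basis_elt (diag_nat d).

(* e_{i,d} and f_{i,d}, for j = i + 1 *)
Definition e_elt (i j : 'I_n) (d : 'I_n -> nat) := basis_elt (move_nat d i j).
Definition f_elt (i j : 'I_n) (d : 'I_n -> nat) := basis_elt (move_nat d j i).

(* The unit of both algebras, the sum of the k_d for d in D(n, r). *)
Definition one_elt : free_mod int :=
  \sum_(d : {ffun 'I_n -> 'I_r.+1} | (\sum_i d i)%N == r) k_elt (fun i => d i).

Definition is_alg_morphism (mul mul' : free_mod int -> free_mod int -> free_mod int)
    (psi : free_mod int -> free_mod int) : Prop :=
  [/\ {morph psi : x y / x + y},
      {morph psi : x y / mul x y >-> mul' x y}
    & psi one_elt = one_elt].

(* Both algebras have the e_A as a basis, so that the same expression denotes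
   the generator of the one and its image in the other. *)
Definition fixes_generators (psi : free_mod int -> free_mod int) : Prop :=
  forall d : 'I_n -> nat, (\sum_i d i)%N = r ->
    psi (k_elt d) = k_elt d /\
    forall i j : 'I_n, j = i.+1 :> nat ->
      ((0 < d j)%N -> psi (e_elt i j d) = e_elt i j d) /\
      ((0 < d i)%N -> psi (f_elt i j d) = f_elt i j d).

End Algebras.

(* Main.v *)
From mathcomp Require Import all_boot all_order all_fingroup all_algebra.
From mathcomp Require Import finfield.
From mathcomp Require Import boolp zify mpoly.
Require Import Defs.

Set Implicit Arguments.
Unset Strict Implicit.
Unset Printing Implicit Defensive.

Import GRing.Theory.

(** The key is a formula for the product of G(n, r). For a matrix [A] let
    [rk A a b] be the sum of the entries in the first [a] rows and the first
    [b] columns; when (f, f') lies in e_A this is dim (f_a cap f'_b), so that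
    [rk A] determines [A]. If (f1, f) is in e_A and (f, f2) in e_B, then
      dim (f1_a cap f2_b) >= rk A a m + rk B m b - dim f_m   for all m,
    and for f1 and f2 in general position the two sides are equal for some m.
    Hence the open orbit of S(A, B) is the one whose rank function is the
    tropical (max-plus) product of those of [A] and [B]
    ([open_orbit_tropical]). Three facts enter: vectors chosen one at a time
    put two given spaces in general position ([generic_pair]); the dimension
    of an intersection is upper semicontinuous ([separator]); and S(A, B) is
    irreducible ([irreducible]), which puts all the pairs of spaces in general
    position at once and makes the open orbit unique. The formula holds over
    every algebraically closed field, and it makes associativity of the
    generic product a statement about maxima ([tropicalA]).

    The isomorphism [closure_map] is not the identity on the basis. It sends
    e_A to the sum of the orbits e_C contained in the closure of e_A, that is,
    with the same dimension vectors and with [rk C >= rk A] ([degen]). It is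
    unitriangular, hence bijective ([closure_map_bij]), and it fixes the
    generators because their orbits are closed: the spaces of the two flags
    form a chain, and no intersection can be larger ([flat],
    [closure_map_flat]).

    It remains to see that it is multiplicative. A polynomial with integer
    coefficients is determined at 0 by its values modulo p at the primes p
    ([horner0_primes]), so structure constants of the 0-Schur algebra are
    numbers of flags over the prime fields, modulo p. For a generator e_G, the
    flags f with (f1, f) in e_G and (f, f2) in the closure of e_B differ from
    f1 in one space, which runs through the lines, or the hyperplanes, of a
    quotient space; their number is 1 modulo p, unless there is none
    ([card_lines], [card_hyperplanes]). There is one exactly if (f1, f2) lies in
    the closure of the generic product of e_G and e_B ([schur0_generator]).
    So the map respects the products with generators
    ([closure_map_generator]). Finally every e_A which is not a k_d is the
    generic product of a generator and an e_B with [B] closer to a diagonal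
    matrix ([reduceP]); as both products are associative, induction on [A]
    gives multiplicativity, and the generators determine the map. *)

(** * Rank functions, the order by closure and tropical products *)

Lemma hiE n (i : 'I_n) : hi i = i.+1 :> nat.
Proof. exact: lift0. Qed.

Lemma eq_hi n (m : 'I_n.+1) (i : 'I_n) : (m == hi i) = (m == i.+1 :> nat).
Proof. by rewrite -val_eqE -hiE. Qed.

Section RankFunctions.
Variable n : nat.
Implicit Types (M N : 'M[nat]_n) (a b m : nat).

(** The dimension of the intersection of the [a]-th and the [b]-th space of
    two flags in relative position [M]. *)
Definition rk M a b := \sum_(i < n | i < a) \sum_(j < n | j < b) M i j.

Lemma rk0l M b : rk M 0 b = 0.
Proof. by rewrite /rk big1. Qed.

Lemma rk0r M a : rk M a 0 = 0.
Proof. by rewrite /rk big1 // => i _; rewrite big1. Qed.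

Lemma rkD M N a b : rk (M + N)%R a b = rk M a b + rk N a b.
Proof.
rewrite /rk -big_split; apply: eq_bigr => i _ /=.
by rewrite -big_split; apply: eq_bigr => j _; rewrite mxE.
Qed.

Lemma rk_delta (i j : 'I_n) a b :
  rk (delta_mx i j)%R a b = ((i < a) && (j < b)).
Proof.
rewrite /rk.
under eq_bigr => i' _.
  rewrite (_ : \sum_(j' < n | j' < b) _ = (i' == i) && (j < b)); last first.
    rewrite [LHS](eq_bigr (fun j' => (i' == i) * (j' == j))); last first.
      by move=> j' _; rewrite mxE; case: eqP; case: eqP.
    rewrite -big_distrr /= big_mkcond (bigD1 j) //= big1 ?addn0; last first.
      by move=> j' /negPf->; case: ifP.
    by rewrite eqxx; case: eqP; case: ltnP.
  over.
rewrite big_mkcond (bigD1 i) //= big1 ?addn0.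
  by rewrite eqxx; case: ifP.
by move=> i' /negPf->; case: ifP.
Qed.

Lemma rk_splitl M a a' b : a <= a' ->
  rk M a' b = rk M a b + \sum_(i < n | a <= i < a') \sum_(j < n | j < b) M i j.
Proof.
move=> aa'; rewrite /rk (bigID (fun i : 'I_n => i < a)) /=; congr (_ + _).
  by apply: eq_bigl => i; lia.
by apply: eq_bigl => i; lia.
Qed.

Lemma rk_tr M a b : rk M^T%R a b = rk M b a.
Proof.
rewrite /rk exchange_big; apply: eq_bigr => i _ /=.
by apply: eq_bigr => j _; rewrite mxE.
Qed.

Lemma rk_mono M a a' b b' : a <= a' -> b <= b' -> rk M a b <= rk M a' b'.
Proof.
move=> aa' bb'; apply: (@leq_trans (rk M a' b)).
  by rewrite (rk_splitl _ _ aa') leq_addr.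
by rewrite -!(rk_tr M) (rk_splitl _ _ bb') leq_addr.
Qed.

(** The difference of the two sides is the sum of the entries in the rows from
    [a] to [a' - 1] and the columns from [b] to [b' - 1]. *)
Lemma rk_super M a a' b b' : a <= a' -> b <= b' ->
  rk M a' b + rk M a b' <= rk M a' b' + rk M a b.
Proof.
move=> aa' bb'; rewrite !(rk_splitl M _ aa').
suff: \sum_(i < n | a <= i < a') \sum_(j < n | j < b) M i j
      <= \sum_(i < n | a <= i < a') \sum_(j < n | j < b') M i j by lia.
apply: leq_sum => i _; rewrite [leqRHS](bigID (fun j : 'I_n => j < b)) /=.
rewrite [X in _ <= X + _](_ : _ = \sum_(j < n | j < b) M i j) ?leq_addr //.
by apply: eq_bigl => j; lia.
Qed.

Lemma rk_entry M (i j : 'I_n) :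
  M i j + (rk M i j.+1 + rk M i.+1 j) = rk M i.+1 j.+1 + rk M i j.
Proof.
rewrite !(rk_splitl M _ (leqnSn i)).
have one F : \sum_(i0 < n | i <= i0 < i.+1) F i0 = F i :> nat.
  by rewrite (big_pred1 i) // => i0 /=; rewrite -val_eqE /=; lia.
rewrite !one [in RHS](bigD1 j) //=.
rewrite [in RHS](eq_bigl (fun j' : 'I_n => j' < j)); first lia.
by move=> j'; rewrite -val_eqE /=; lia.
Qed.

Lemma rk_inj M N :
  (forall a b : 'I_n.+1, rk M a b = rk N a b) -> M = N.
Proof.
move=> eq_rk; apply/matrixP => i j.
have:= rk_entry M i j; have := rk_entry N i j.
have := eq_rk (lo i) (lo j); have := eq_rk (lo i) (hi j).
have := eq_rk (hi i) (lo j); have := eq_rk (hi i) (hi j).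
by rewrite !hiE /=; lia.
Qed.

Lemma rk_total M : rk M n n = \sum_i \sum_j M i j.
Proof.
rewrite /rk; apply: eq_big => [i|i _]; first by rewrite ltn_ord.
by apply: eq_bigl => j; rewrite ltn_ord.
Qed.

End RankFunctions.

Section Tropical.
Variable n : nat.
Implicit Types (A B C G : 'M[nat]_n).

Definition composable A B := [forall m : 'I_n.+1, rk A n m == rk B m n].

Lemma composableP A B :
  reflect (forall m : 'I_n.+1, rk A n m = rk B m n) (composable A B).
Proof. by apply: (iffP forallP) => H m; apply/eqP. Qed.

Definition same_margins A C : bool :=
  [forall a : 'I_n.+1, (rk C a n == rk A a n) && (rk C n a == rk A n a)].

(** The order by closure of the orbits. The row and column sums are the
    dimension vectors of the two flags, which do not change in a closure. *)
Definition degen C A : bool :=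
  same_margins A C && [forall a : 'I_n.+1, forall b : 'I_n.+1, rk A a b <= rk C a b].

Lemma degenP C A :
  reflect [/\ forall a : 'I_n.+1, rk C a n = rk A a n,
              forall a : 'I_n.+1, rk C n a = rk A n a
            & forall a b : 'I_n.+1, rk A a b <= rk C a b]
          (degen C A).
Proof.
apply: (iffP andP) => [[/forallP mar /forallP le]|[row col le]]; split.
- by move=> a; have /andP[/eqP] := mar a.
- by move=> a; have /andP[_ /eqP] := mar a.
- by move=> a b; have /forallP := le a.
- by apply/forallP => a; rewrite row col !eqxx.
- by apply/forallP => a; apply/forallP.
Qed.

Lemma degen_refl A : degen A A.
Proof. by apply/degenP; split. Qed.

Lemma degen_anti A B : degen A B -> degen B A -> A = B.
Proof.
move=> /degenP[_ _ leAB] /degenP[_ _ leBA]; apply: rk_inj => a b.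
by apply/eqP; rewrite eqn_leq leAB leBA.
Qed.

(** The max-plus product of the rank functions, normalised by the dimensions
    [rk A n m] of the middle flag. The maximum is described by a bound and a
    place where it is attained, and without truncated subtractions. *)
Definition tropical A B C :=
  [/\ composable A B,
      forall a : 'I_n.+1, rk C a n = rk A a n,
      forall b : 'I_n.+1, rk C n b = rk B n b,
      forall a m b : 'I_n.+1, rk A a m + rk B m b <= rk C a b + rk A n m
    & forall a b : 'I_n.+1,
        exists m : 'I_n.+1, rk C a b + rk A n m = rk A a m + rk B m b].

Lemma tropical_inj A B C C' : tropical A B C -> tropical A B C' -> C = C'.
Proof.
move=> [_ _ _ le eq] [_ _ _ le' eq']; apply: rk_inj => a b.
have [m em] := eq a b; have [m' em'] := eq' a b.
by have := le a m' b; have := le' a m b; lia.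
Qed.

Lemma tropicalA G A B GA AB E :
  tropical G A GA -> tropical A B AB -> tropical G AB E -> tropical GA B E.
Proof.
move=> [_ r1 c1 le1 eq1] [/composableP k2 r2 c2 le2 eq2].
move=> [_ r3 c3 le3 eq3].
have le (a m b : 'I_n.+1) : rk GA a m + rk B m b <= rk E a b + rk GA n m.
  have [l] := eq1 a m; have := le2 l m b; have := le3 a l b; have := c1 m; lia.
split=> //.
- by apply/composableP => m; rewrite c1 k2.
- by move=> a; rewrite r3 r1.
- by move=> b; rewrite c3 c2.
move=> a b; have [l el] := eq3 a b; have [m em] := eq2 l b.
by exists m; have := le a m b; have := le1 a l m; have := c1 m; lia.
Qed.

Lemma tropical_composable A B C D : tropical A B C ->
  composable C D = composable B D.
Proof.
by move=> [_ _ cC _ _]; apply: eq_forallb => m; rewrite cC.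
Qed.

(** A maximum is a least upper bound, so membership in the closure is a family
    of inequalities, one for each space of the middle flag. *)
Lemma degen_tropical A B C E : tropical A B E ->
  degen C E <->
    [/\ forall a : 'I_n.+1, rk C a n = rk A a n,
        forall b : 'I_n.+1, rk C n b = rk B n b
      & forall a m b : 'I_n.+1, rk A a m + rk B m b <= rk C a b + rk A n m].
Proof.
move=> [_ rE cE leE eqE]; split=> [/degenP[r c le]|[r c le]].
  split=> [a|b|a m b]; rewrite ?r ?c //.
  by have := leE a m b; have := le a b; lia.
apply/degenP; split=> [a|b|a b]; rewrite ?rE ?cE //.
by have [m] := eqE a b; have := le a m b; lia.
Qed.

End Tropical.

Section Generators.
Variable n : nat.
Implicit Types (A B C G : 'M[nat]_n) (d : 'I_n -> nat).

(** The relative positions in which the spaces of the two flags form a single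
    chain. *)
Definition flat G :=
  forall a b : 'I_n.+1, rk G a b = minn (rk G a n) (rk G n b).

Lemma rk_diag d a b :
  rk (diag_nat d) a b = \sum_(i < n | i < minn a b) d i.
Proof.
rewrite /rk [LHS](eq_bigr (fun i : 'I_n => if i < b then d i else 0)).
  rewrite -big_mkcondr; apply: eq_bigl => i; lia.
move=> i _; rewrite big_mkcond (bigD1 i) //= mxE eqxx big1 ?addn0 //.
by move=> j; rewrite mxE eq_sym => /negPf->; case: ifP.
Qed.

Definition dsum d a := \sum_(i < n | i < a) d i.

Lemma dsum_mono d a b : a <= b -> dsum d a <= dsum d b.
Proof.
move=> ab; rewrite /dsum [leqRHS](bigID (fun i : 'I_n => i < a)) /=.
rewrite [X in _ <= X + _](_ : _ = dsum d a) ?leq_addr //.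
by apply: eq_bigl => i; lia.
Qed.

Lemma dsumS d (i : 'I_n) : dsum d i.+1 = dsum d i + d i.
Proof.
rewrite /dsum (bigD1 i) //= addnC; congr (_ + _); apply: eq_bigl => j.
by rewrite -val_eqE /=; lia.
Qed.

(** The matrix of a generator is a diagonal matrix with one unit moved up or
    down; written as a sum, it has a rank function that is known. *)
Lemma move_delta d (i j : 'I_n) : i != j -> 0 < d j ->
  (move_nat d i j + delta_mx j j = diag_nat d + delta_mx i j)%R.
Proof.
move=> ij dj; apply/matrixP => a b; rewrite !mxE.
have ji : (j == i) = false by rewrite eq_sym (negPf ij).
case: (eqVneq a j) => [ea|aj]; case: (eqVneq b j) => [eb|bj]; subst;
  rewrite ?eqxx ?ji ?andbF ?(negPf aj) //=.
- by rewrite [((_ : nat) + _)%R]addn1 prednK // GRing.addr0.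
- by case: (eqVneq a i) => [ea|_]; rewrite ?(negPf aj) //; subst; rewrite (negPf aj).
Qed.

Lemma rk_move d (i j : 'I_n) a b : i != j -> 0 < d j ->
  rk (move_nat d i j) a b + ((j < a) && (j < b))
  = dsum d (minn a b) + ((i < a) && (j < b)).
Proof.
move=> ij dj; rewrite -!rk_delta (_ : dsum d _ = rk (diag_nat d) a b).
  by rewrite -!rkD move_delta.
by rewrite rk_diag.
Qed.

Lemma flat_k d : flat (diag_nat d) /\
  forall m : 'I_n.+1, rk (diag_nat d) m n = rk (diag_nat d) n m.
Proof.
split=> [a b|m]; rewrite !rk_diag -!/(dsum d _); last by rewrite minnC.
rewrite (minn_idPl (ltn_ord a : a <= n)) (minn_idPr (ltn_ord b : b <= n)).
by case: (leqP a b) => ab; [rewrite (minn_idPl _) | rewrite (minn_idPr _)];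
  rewrite ?dsum_mono // ltnW.
Qed.

(** The shape of the e_{i,d}: only the [x]-th space changes, and it is larger
    by one dimension in the first flag. *)
Definition up_step G (x : 'I_n.+1) := flat G /\
  forall m : 'I_n.+1, rk G m n = rk G n m + (m == x).

(** The shape of the f_{i,d}, for which the first flag has the smaller [x]-th
    space. *)
Definition down_step G (x : 'I_n.+1) := flat G /\
  forall m : 'I_n.+1, rk G n m = rk G m n + (m == x).

Lemma up_step_e d (i j : 'I_n) : j = i.+1 :> nat -> 0 < d j ->
  up_step (move_nat d i j) (hi i) /\
  forall m : 'I_n.+1, rk (move_nat d i j) n m = dsum d m.
Proof.
move=> ji dj; have ij : i != j by rewrite -val_eqE /= ji neq_ltn leqnn.
have rkE a b := rk_move a b ij dj.
have leS : dsum d j.+1 = dsum d j + d j := dsumS d j.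
have cE (m : 'I_n.+1) : rk (move_nat d i j) n m = dsum d m.
  have := rkE n m; rewrite (minn_idPr (ltn_ord m : m <= n)).
  by rewrite !ltn_ord => /addIn.
have rE (m : 'I_n.+1) : rk (move_nat d i j) m n = dsum d m + (m == hi i).
  have := rkE m n; rewrite (minn_idPl (ltn_ord m : m <= n)).
  by rewrite eq_hi !ltn_ord !andbT; lia.
split=> //; split=> [a b|m]; rewrite ?cE rE //.
have := rkE a b; rewrite eq_hi -ji.
have [ab|ba] := leqP a b.
  have := dsum_mono d ab; case: (eqVneq (a : nat) j) => aj /=; last by lia.
  case: (ltngtP a b) ab => // ab _; last by rewrite ab; lia.
  by have := dsum_mono d ab; rewrite aj leS; lia.
by have := dsum_mono d (ltnW ba); case: (eqVneq (a : nat) j) => aj /=; lia.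
Qed.

Lemma down_step_f d (i j : 'I_n) : j = i.+1 :> nat -> 0 < d i ->
  down_step (move_nat d j i) (hi i) /\
  forall m : 'I_n.+1, rk (move_nat d j i) n m = dsum d m.
Proof.
move=> ji di; have ij : j != i by rewrite -val_eqE /= ji neq_ltn leqnn orbT.
have rkE a b := rk_move a b ij di.
have leS : dsum d j = dsum d i + d i by rewrite ji dsumS.
have cE (m : 'I_n.+1) : rk (move_nat d j i) n m = dsum d m.
  have := rkE n m; rewrite (minn_idPr (ltn_ord m : m <= n)).
  by rewrite !ltn_ord => /addIn.
have rE (m : 'I_n.+1) : rk (move_nat d j i) m n + (m == hi i) = dsum d m.
  have := rkE m n; rewrite (minn_idPl (ltn_ord m : m <= n)).
  rewrite eq_hi !ltn_ord !andbT.
  by case: (eqVneq (m : nat) j) => mj /=; rewrite ?mj; lia.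
split=> //; split=> [a b|m]; rewrite ?cE ?rE //.
have := rkE a b; have := rE a; rewrite eq_hi -ji.
have [ab|ba] := leqP a b.
  by have := dsum_mono d ab; case: (eqVneq (a : nat) j) => aj /=; lia.
have := dsum_mono d (ltnW ba); case: (eqVneq (a : nat) j) => aj /=; last by lia.
have : b <= i by lia.
by move/(dsum_mono d); rewrite aj; lia.
Qed.

End Generators.

(** * Factoring a matrix through generators *)

Section Reduction.
Variable n : nat.
Implicit Types (A B C G : 'M[nat]_n) (d : 'I_n -> nat).

Lemma rk_row A (i : 'I_n) b : rk A i.+1 b = rk A i b + \sum_(j < n | j < b) A i j.
Proof.
rewrite (rk_splitl _ _ (leqnSn i)) (big_pred1 i) // => i' /=.
by rewrite -val_eqE /=; lia.
Qed.

(** Multiplication by e_{i,d} moves one unit from row [i + 1] to row [i], in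
    the last column where row [i + 1] has one. For [a <> i + 1] the maximum is
    attained at [m = a]; for [a = i + 1] it is attained at [m = i + 1] in the
    columns up to [p], and at [m = i + 2] in those beyond. *)
Lemma tropical_up G A A' B (i j p : 'I_n) :
    j = i.+1 :> nat -> up_step G (hi i) -> composable G A' ->
    A = (B + delta_mx i p)%R -> A' = (B + delta_mx j p)%R ->
    (forall q : 'I_n, p < q -> A j q = 0) ->
  tropical G A' A.
Proof.
move=> ji [Gf Gr] /[dup] GA' /composableP Gc EA EA' A0.
have rA a b : rk A a b = rk B a b + ((i < a) && (p < b)).
  by rewrite EA rkD rk_delta.
have rA' a b : rk A' a b = rk B a b + ((j < a) && (p < b)).
  by rewrite EA' rkD rk_delta.
have rn (a : 'I_n.+1) : rk G a n = rk A' a n + (a == i.+1 :> nat).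
  by rewrite Gr Gc eq_hi.
have le (a m b : 'I_n.+1) : rk G a m + rk A' m b <= rk A a b + rk G n m.
  rewrite Gf Gc rn.
  have := ltn_ord a; have := ltn_ord b; have := ltn_ord m; have := ltn_ord p.
  have := rA a b; have := rA' a b; have := rA' m b; have := rA a n.
  have := rA' a n; have := rA' m n; have := rA m b; have := rA m n.
  have [<-|] := eqVneq (a : nat) m; first by lia.
  have [am|ma] := leqP a m; rewrite ?ltnS.
    move=> *; have := rk_super A' am (ltn_ord b : b <= n).
    by have := rk_super A am (ltn_ord b : b <= n); lia.
  by have := rk_mono A' (ltnW ma) (leqnn b); lia.
split=> //.
- move=> a; rewrite rn rA rA' !ltn_ord !andbT; lia.
- by move=> b; rewrite rA rA' !ltn_ord.
move=> a b; case: (eqVneq (a : nat) i.+1) => [ai|ai].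
  have [bp|pb] := leqP b p.
    exists a; rewrite Gf Gc rn; have := rA a b; have := rA' a b; lia.
  exists (hi j); rewrite Gf Gc rn hiE.
  have R : rk A j.+1 b + rk A j n = rk A j.+1 n + rk A j b.
    rewrite !rk_row; suff -> : \sum_(j0 < n | j0 < n) A j j0
      = \sum_(j0 < n | j0 < b) A j j0 by lia.
    rewrite [LHS](bigID (fun q : 'I_n => q < b)) /= addnC big1 ?add0n.
      by apply: eq_bigl => q; rewrite ltn_ord.
    by move=> q /andP[_ qb]; apply: A0; lia.
  have := ltn_ord b; have := ltn_ord i; have := ltn_ord p.
  have := rA a b; have := rA' a n; have := rA' j.+1 n; have := rA' j.+1 b.
  have := rA j.+1 n; have := rA j.+1 b; have := rA a n.
  have := rk_mono B (leqnSn j) (leqnn n); have := rA' j n.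
  by rewrite !ai -ji in R *; lia.
exists a; rewrite Gf Gc rn (negPf ai) addn0 minnn.
by have := rA a b; have := rA' a b; lia.
Qed.

(** Multiplication by f_{i,d} moves one unit from row [i] to row [i + 1], in
    the first column where row [i] has one. For [a = i + 1] the maximum is
    attained at [m = i + 1] in the columns beyond [p], and at [m = i] in those
    up to [p]. *)
Lemma tropical_down G A A' B (i j p : 'I_n) :
    j = i.+1 :> nat -> down_step G (hi i) -> composable G A' ->
    A = (B + delta_mx j p)%R -> A' = (B + delta_mx i p)%R ->
    (forall q : 'I_n, q < p -> A i q = 0) ->
  tropical G A' A.
Proof.
move=> ji [Gf Gr] /[dup] GA' /composableP Gc EA EA' A0.
have rA a b : rk A a b = rk B a b + ((j < a) && (p < b)).
  by rewrite EA rkD rk_delta.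
have rA' a b : rk A' a b = rk B a b + ((i < a) && (p < b)).
  by rewrite EA' rkD rk_delta.
have rn (a : 'I_n.+1) : rk A' a n = rk G a n + (a == i.+1 :> nat).
  by rewrite -Gc Gr eq_hi.
have le (a m b : 'I_n.+1) : rk G a m + rk A' m b <= rk A a b + rk G n m.
  rewrite Gf Gc.
  have := rn a; have := ltn_ord p.
  have := ltn_ord a; have := ltn_ord b; have := ltn_ord m.
  have := rA a b; have := rA' a b; have := rA' m b; have := rA a n.
  have := rA' a n; have := rA' m n; have := rA m b; have := rA m n.
  have [<-|] := eqVneq (a : nat) m; first by lia.
  have [am|ma] := leqP a m; rewrite ?ltnS.
    move=> *; have := rk_super A' am (ltn_ord b : b <= n).
    by have := rk_super A am (ltn_ord b : b <= n); lia.
  move=> *; have := rk_mono A' (ltnW ma) (leqnn b).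
  by have := rk_mono A (ltnW ma) (leqnn b); lia.
split=> //.
- move=> a; have := rn a; rewrite rA rA' !ltn_ord !andbT; lia.
- by move=> b; rewrite rA rA' !ltn_ord.
move=> a b; case: (eqVneq (a : nat) i.+1) => [ai|ai].
  have [pb|bp] := ltnP p b.
    exists a; rewrite Gf Gc; have := rA a b; have := rA' a b; have := rn a; lia.
  exists (lo i); rewrite Gf Gc /=.
  have R : rk A a b = rk A i b.
    by rewrite ai rk_row big1 ?addn0 // => q qb; apply: A0; lia.
  have := rA a b; have := rA' i b; have := rA i b; have := rn (lo i) => /=.
  have := rn a; have := rk_mono B (leqnSn i) (leqnn n).
  by have := ltn_ord p; have := rA' i n; have := rA' i.+1 n; rewrite !ai in R *; lia.
exists a; rewrite Gf Gc; have := rn a; rewrite (negPf ai).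
by have := rA a b; have := rA' a b; lia.
Qed.

(** The distance to the diagonal matrices, on which the factorisation into
    generators is an induction. *)
Definition offdiag A := \sum_(i < n) \sum_(j < n) A i j * ((i - j) + (j - i)).

Lemma offdiagD A B : offdiag (A + B)%R = offdiag A + offdiag B.
Proof.
rewrite /offdiag -big_split; apply: eq_bigr => i _ /=.
by rewrite -big_split; apply: eq_bigr => j _ /=; rewrite mxE mulnDl.
Qed.

Lemma offdiag_delta (i j : 'I_n) : offdiag (delta_mx i j)%R = (i - j) + (j - i).
Proof.
rewrite /offdiag (bigD1 i) //= (bigD1 j) //= !big1 ?addn0.
- by rewrite mxE !eqxx mul1n.
- by move=> i' /negPf i'i; rewrite big1 // => j' _; rewrite mxE i'i.
- by move=> j' /negPf j'j; rewrite mxE j'j andbF.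
Qed.

Lemma sub_delta A (i j : 'I_n) : 0 < A i j -> exists B, A = (B + delta_mx i j)%R.
Proof.
move=> Aij; exists (\matrix_(a, b) (A a b - ((a == i) && (b == j)))%N)%R.
apply/matrixP => a b; rewrite !mxE.
case: (boolP ((a == i) && (b == j))) => [/andP[/eqP-> /eqP->]|_].
  by rewrite [RHS]subnK.
by rewrite subn0 GRing.addr0.
Qed.

Definition rowsum A (i : 'I_n) := \sum_j A i j.

Lemma dsum_rowsum A a : dsum (rowsum A) a = rk A a n.
Proof.
by apply: eq_bigr => i _; apply: eq_bigl => j; rewrite ltn_ord.
Qed.

Variant reduction A : Prop :=
| ReduceDiag d of A = diag_nat d
| ReduceUp (i j : 'I_n) d A' of j = i.+1 :> nat & 0 < d j
    & offdiag A' < offdiag A & dsum d n = rk A n n & rk A' n n = rk A n n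
    & tropical (move_nat d i j) A' A
| ReduceDown (i j : 'I_n) d A' of j = i.+1 :> nat & 0 < d i
    & offdiag A' < offdiag A & dsum d n = rk A n n & rk A' n n = rk A n n
    & tropical (move_nat d j i) A' A.

(** Among the entries above the diagonal, one in the last possible column can
    be pushed down: in the next row, everything further to the right would
    again be above the diagonal. Below the diagonal, the first possible column
    does it, in the other direction. *)
Lemma reduceP A : reduction A.
Proof.
case: (pickP [pred u : 'I_n * 'I_n | (u.1 < u.2) && (0 < A u.1 u.2)]) =>
    [u0 Pu0|noup].
  case: (@arg_maxnP _ u0 (fun u : 'I_n * 'I_n => (u.1 < u.2) && (0 < A u.1 u.2))
    (fun u => u.2 : nat) Pu0) => -[i p] /= /andP[ip Aip] pmax.
  have jP : i.+1 < n by have := ltn_ord p; lia.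
  pose j := Ordinal jP; have [B EA] := sub_delta Aip.
  pose A' := (B + delta_mx j p)%R; pose d := rowsum A'.
  have dj : 0 < d j.
    by rewrite /d /rowsum (bigD1 p) //= !mxE !eqxx [(_ + _)%R]addn1.
  have [Gu Gc] := up_step_e (erefl : j = i.+1 :> nat) dj.
  have tot : rk A' n n = rk A n n by rewrite EA !rkD !rk_delta !ltn_ord.
  apply: (@ReduceUp A i j d A') => //.
  - by rewrite EA !offdiagD !offdiag_delta /=; lia.
  - by rewrite dsum_rowsum.
  apply: (tropical_up (erefl : j = i.+1 :> nat) Gu _ EA erefl).
    by apply/composableP => m; rewrite Gc dsum_rowsum.
  move=> q pq; apply/eqP; rewrite -leqn0 leqNgt; apply/negP => Ajq.
  by have := pmax (j, q); rewrite /= Ajq; lia.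
case: (pickP [pred u : 'I_n * 'I_n | (u.2 < u.1) && (0 < A u.1 u.2)]) =>
    [u0 Pu0|nodown].
  case: (@arg_minnP _ u0 (fun u : 'I_n * 'I_n => (u.2 < u.1) && (0 < A u.1 u.2))
    (fun u => u.2 : nat) Pu0) => -[j p] /= /andP[pj Ajp] pmin.
  have iP : j.-1 < n by have := ltn_ord j; lia.
  pose i := Ordinal iP; have [B EA] := sub_delta Ajp.
  have ji : j = i.+1 :> nat by rewrite /= prednK //; lia.
  pose A' := (B + delta_mx i p)%R; pose d := rowsum A'.
  have di : 0 < d i.
    by rewrite /d /rowsum (bigD1 p) //= !mxE !eqxx [(_ + _)%R]addn1.
  have [Gu Gc] := down_step_f ji di.
  have tot : rk A' n n = rk A n n by rewrite EA !rkD !rk_delta !ltn_ord.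
  apply: (@ReduceDown A i j d A') => //.
  - by rewrite EA !offdiagD !offdiag_delta /=; lia.
  - by rewrite dsum_rowsum.
  apply: (tropical_down ji Gu _ EA erefl).
    by apply/composableP => m; rewrite Gc dsum_rowsum.
  move=> q qp; apply/eqP; rewrite -leqn0 leqNgt; apply/negP => Aiq.
  by have := pmin (i, q); rewrite /= Aiq; lia.
apply: (@ReduceDiag A (fun i => A i i)); apply/matrixP => i j; rewrite mxE.
case: eqVneq => [->//|]; rewrite neq_ltn => /orP[ij|ji].
  by have /= := noup (i, j); rewrite ij lt0n => /negbFE/eqP.
by have /= := nodown (i, j); rewrite ji lt0n => /negbFE/eqP.
Qed.

End Reduction.

(** * Orbits of pairs of flags *)

Section FlagOrbits.
Variables (k : fieldType) (n r : nat).
Implicit Types (f h : flag k n r) (U W : {vspace 'rV[k]_r}) (G : 'M[k]_r).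
Local Open Scope ring_scope.

(** The cells are in direct sum, and those before [(a, b)] span the
    intersection. *)
Lemma dim_cap f f' (a b : 'I_n.+1) :
  \dim (f a :&: f' b)%VS = rk (relpos f f') a b.
Proof.
have -> : rk (relpos f f') a b
    = (\sum_(p : 'I_n * 'I_n | (p.1 < a)%N && (p.2 < b)%N) \dim (cell f f' p))%N.
  rewrite /rk pair_big /=; apply: eq_bigr => p _.
  by rewrite relposE.
rewrite cap_cells; pose P := fun p : 'I_n * 'I_n => (p.1 < a)%N && (p.2 < b)%N.
change (\dim (\sum_(p | P p) cell f f' p)%VS
  = \sum_(p | P p) \dim (cell f f' p))%N.
have leP := dimv_leq_sum (index_enum _) P (cell f f').
have leC := dimv_leq_sum (index_enum _) (fun p => ~~ P p) (cell f f').
have /directvP /= := cells_direct f f'.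
rewrite (bigID P) /= [RHS](bigID P) /=.
have := dimv_add_leqif (\sum_(p | P p) cell f f' p)%VS
  (\sum_(p | ~~ P p) cell f f' p)%VS.
by case=> le _; move: leP leC le => /=; lia.
Qed.

Lemma relposP f f' M :
  (relpos f f' = M) <->
  (forall a b : 'I_n.+1, \dim (f a :&: f' b)%VS = rk M a b).
Proof.
split=> [<- a b|H]; first exact: dim_cap.
by apply: rk_inj => a b; rewrite -dim_cap.
Qed.

Lemma in_orbitP (A : posmx n r) f f' :
  reflect (forall a b : 'I_n.+1, \dim (f a :&: f' b)%VS = rk (natmx A) a b)
          (in_orbit A f f').
Proof. by apply: (iffP eqP) => /relposP. Qed.

Lemma in_orbit_dim (A : posmx n r) f f' : in_orbit A f f' ->
  (forall a : 'I_n.+1, \dim (f a) = rk (natmx A) a n) /\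
  (forall b : 'I_n.+1, \dim (f' b) = rk (natmx A) n b).
Proof.
move=> /in_orbitP oA; split=> [a|b].
  by rewrite -(oA a ord_max) flag_max capvf.
by rewrite -(oA ord_max b) flag_max capfv.
Qed.

Lemma in_orbit_relpos f f' : exists A : posmx n r, in_orbit A f f'.
Proof.
by have [A eA] := natmx_surj (sum_relpos f f'); exists A; rewrite /in_orbit eA.
Qed.

Lemma in_orbit_inj (A B : posmx n r) f f' :
  in_orbit A f f' -> in_orbit B f f' -> A = B.
Proof. by move=> /eqP oA /eqP oB; apply: natmx_inj; rewrite -oA -oB. Qed.

Definition act G U : {vspace 'rV[k]_r} := (linfun (mulmxr G) @: U)%VS.

Lemma act_lker G : G \in unitmx -> lker (linfun (mulmxr G : 'rV_r -> 'rV_r)) == 0%VS.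
Proof.
move=> uG; apply/lker0P => u v; rewrite !lfunE /= => /(congr1 (mulmxr (invmx G))).
by rewrite /= !mulmxK.
Qed.

Lemma is_flag_act G f : G \in unitmx -> is_flag [ffun i => act G (f i)].
Proof.
move=> uG; apply/and3P; split; rewrite ?ffunE.
- by rewrite flag0 /act limg0.
- by rewrite flag_max /act lker0_limgf ?act_lker.
- by apply/forallP => i; rewrite !ffunE limgS ?flag_step.
Qed.

(** The value is [f] itself if [G] is not invertible. *)
Definition flag_act G f : flag k n r := insubd f [ffun i => act G (f i)].

Lemma flag_actE G f i : G \in unitmx -> flag_act G f i = act G (f i).
Proof.
by move=> uG; rewrite /flag_act /insubd insubT ?is_flag_act // => ?; rewrite ffunE.
Qed.

Lemma flag_ext f h : (forall i, f i = h i) -> f = h.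
Proof. by move=> fh; apply/val_inj/ffunP. Qed.

Lemma actM G H U : act (G *m H) U = act H (act G U).
Proof.
rewrite /act -limg_comp; congr (_ @: _)%VS; apply/lfunP => v.
by rewrite comp_lfunE !lfunE /= mulmxA.
Qed.

Lemma flag_actM G H f : G \in unitmx -> H \in unitmx ->
  flag_act (G *m H) f = flag_act H (flag_act G f).
Proof.
move=> uG uH; apply: flag_ext => i.
by rewrite !flag_actE ?unitmx_mul ?uG // actM.
Qed.

Lemma act1 U : act 1%:M U = U.
Proof.
rewrite /act (_ : linfun _ = \1%VF) ?lim1g //.
by apply/lfunP => v; rewrite lfunE /= mulmx1 id_lfunE.
Qed.

Lemma flag_act1 f : flag_act 1%:M f = f.
Proof. by apply: flag_ext => i; rewrite flag_actE ?unitmx1 // act1. Qed.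

Lemma dim_act G U : G \in unitmx -> \dim (act G U) = \dim U.
Proof. by move=> uG; rewrite limg_dim_eq // (eqP (act_lker uG)) capv0. Qed.

Lemma act_cap G U W : G \in unitmx -> act G (U :&: W)%VS = (act G U :&: act G W)%VS.
Proof. by move=> uG; rewrite /act lker0_img_cap ?act_lker. Qed.

Lemma in_orbit_act G (A : posmx n r) f f' : G \in unitmx ->
  in_orbit A (flag_act G f) (flag_act G f') = in_orbit A f f'.
Proof.
move=> uG; congr (_ == _); apply/relposP => a b.
by rewrite !flag_actE // -act_cap // dim_act // dim_cap.
Qed.

(** The transitivity of the general linear group on an orbit, for invertible
    matrices in place of linear maps. *)
Lemma same_relpos_act f f' h h' : relpos f f' = relpos h h' ->
  exists2 G, G \in unitmx & flag_act G f = h /\ flag_act G f' = h'.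
Proof.
move=> /same_orbitP[g g0 gE]; pose G := lin1_mx g.
have gG U : (g @: U)%VS = act G U.
  rewrite /act; congr (_ @: _)%VS; apply/lfunP => v.
  by rewrite lfunE /= mul_rV_lin1.
have uG : G \in unitmx.
  rewrite -row_free_unit -kermx_eq0; apply/eqP/row_matrixP => i.
  rewrite row0; apply: (lker0P g0); rewrite linear0 -mul_rV_lin1 -/G.
  by rewrite -row_mul mulmx_ker row0.
exists G => //; split; apply: flag_ext => i; rewrite flag_actE // -gG.
  by have [] := gE i.
by have [] := gE i.
Qed.

(** Flags made of these realise every matrix: sort the vectors of the
    canonical basis into cells, with as many vectors in a cell as the matrix
    says. *)
Definition coord_space (S : {set 'I_r}) : {vspace 'rV[k]_r} :=
  (\sum_(x in S) <[delta_mx 0%R x]>)%VS.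

Lemma mem_coord_space S v :
  (v \in coord_space S) = [forall x, (x \notin S) ==> (v 0 x == 0)].
Proof.
apply/memv_sumP/forallP => [[u uP ->] x|v0].
  apply/implyP => xS; rewrite summxE big1 // => y yS.
  have /vlineP[c ->] := uP y yS; rewrite !mxE eqxx /=.
  by case: eqP => [xy|]; rewrite ?mulr0 //; rewrite xy yS in xS.
exists (fun x => v 0 x *: delta_mx 0 x) => [x _|]; first by rewrite memvZ ?memv_line.
rewrite {1}[v]row_sum_delta (bigID (mem S)) /= [X in _ + X]big1 ?addr0 // => x xS.
by have /implyP/(_ xS)/eqP-> := v0 x; rewrite scale0r.
Qed.

Lemma coord_spaceT : coord_space [set: 'I_r] = fullv.
Proof.
apply/eqP; rewrite eqEsubv subvf; apply/subvP => v _.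
by rewrite mem_coord_space; apply/forallP => x; rewrite inE.
Qed.

Lemma coord_spaceI S T :
  (coord_space S :&: coord_space T)%VS = coord_space (S :&: T).
Proof.
apply/vspaceP => v; rewrite memv_cap !mem_coord_space.
apply/andP/forallP => [[/forallP vS /forallP vT] x|vST].
  by have := vS x; have := vT x; rewrite inE negb_and; do 2!case: (_ \in _).
split; apply/forallP => x; have := vST x; rewrite inE negb_and.
  by case: (x \in S).
by case: (x \in T); rewrite ?orbT ?orbF.
Qed.

Lemma dim_coord_space S : \dim (coord_space S) = #|S|.
Proof.
have le T : (\dim (coord_space T) <= #|T|)%N.
  apply: leq_trans (dimv_leq_sum _ _ _) _; rewrite -sum1_card; apply: leq_sum => x _.
  by rewrite dim_vline; case: (_ != _).
have := le S; have := le (~: S); have := cardsC S.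
have : (fullv <= coord_space S + coord_space (~: S))%VS.
  rewrite -coord_spaceT; apply/subv_sumP => x _; have [xS|xS] := boolP (x \in S).
    by apply: subv_trans (addvSl _ _); apply: (sumv_sup x).
  by apply: subv_trans (addvSr _ _); apply: (sumv_sup x); rewrite ?inE.
move=> /dimvS; rewrite dimvf /dim /= mul1n card_ord.
have := dimv_add_leqif (coord_space S) (coord_space (~: S)).
by case=> le' _; lia.
Qed.

Lemma is_flag_coord (lab : 'I_r -> 'I_n) :
  is_flag [ffun a : 'I_n.+1 => coord_space [set x | (lab x < a)%N]].
Proof.
apply/and3P; split; rewrite ?ffunE.
- rewrite -dimv_eq0 dim_coord_space cards_eq0; apply/eqP/setP => x.
  by rewrite !inE.
- rewrite -coord_spaceT; apply/eqP; congr coord_space; apply/setP => x.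
  by rewrite !inE ltn_ord.
- apply/forallP => i; rewrite !ffunE; apply/subvP => v; rewrite !mem_coord_space.
  move=> /forallP v0; apply/forallP => x; have := v0 x; rewrite !inE hiE /=.
  by case: ltngtP => //; case: ltngtP => //; lia.
Qed.

(** The elements of [T] are the units of [A], each of them in its cell; there
    are [r] of them. *)
Lemma labelling (A : posmx n r) : exists lab : 'I_r -> 'I_n * 'I_n,
  forall P : pred ('I_n * 'I_n),
    #|[set x | P (lab x)]| = (\sum_(p | P p) natmx A p.1 p.2)%N.
Proof.
pose T : finType := {x : ('I_n * 'I_n) * 'I_r.+1 | (x.2 < natmx A x.1.1 x.1.2)%N}.
have cardP (P : pred ('I_n * 'I_n)) :
    #|[set x : T | P (val x).1]| = (\sum_(p | P p) natmx A p.1 p.2)%N.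
  rewrite -(card_imset _ val_inj).
  have -> : [set val x | x in [set x : T | P (val x).1]]
      = [set y : ('I_n * 'I_n) * 'I_r.+1 | P y.1 && (y.2 < natmx A y.1.1 y.1.2)%N].
    apply/setP => y; rewrite inE; apply/imsetP/andP => [[x xP ->]|[Py ly]].
      by rewrite inE in xP; split=> //; apply: (valP x).
    by exists (Sub y ly); rewrite ?inE ?SubK.
  rewrite -sum1_card; transitivity (\sum_(y : ('I_n * 'I_n) * 'I_r.+1
      | P y.1 && (y.2 < natmx A y.1.1 y.1.2)%N) 1)%N.
    by apply: eq_bigl => y; rewrite inE.
  rewrite -(pair_big_dep P (fun p (c : 'I_r.+1) => (c < natmx A p.1 p.2)%N)
    (fun _ _ => 1%N)) /=.
  apply: eq_bigr => p _; rewrite sum1_card.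
  have : (natmx A p.1 p.2 <= r.+1)%N by rewrite mxE ltnW // ltn_ord.
  move=> le; have inj : injective (widen_ord le).
    by move=> x y /(congr1 val) /= /val_inj.
  rewrite -[RHS]card_ord -(card_image inj).
  apply: eq_card => c; apply/idP/imageP => [lc|[c' _ ->]].
    by exists (Ordinal lc) => //; apply: val_inj.
  exact: (@ltn_ord (natmx A p.1 p.2) c').
have cT : r = #|T|.
  have := cardP xpredT; rewrite (_ : [set x | _] = [set: T]); last first.
    by apply/setP => x; rewrite !inE.
  rewrite cardsT => ->; rewrite -(pair_big xpredT xpredT
    (fun i j => natmx A i j)) /= -[LHS](eqP (posmxP A)).
  by apply: eq_bigr => i _; apply: eq_bigr => j _; rewrite mxE.
exists (fun x => (val (enum_val (cast_ord cT x))).1) => P; rewrite -cardP.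
have inj : injective (fun x => enum_val (cast_ord cT x) : T).
  by move=> x y /enum_val_inj /cast_ord_inj.
rewrite -(card_imset _ inj); apply: eq_card => y; rewrite !inE.
apply/imsetP/idP => [[x xP ->]|Py]; first by rewrite inE in xP.
exists (cast_ord (esym cT) (enum_rank y)); rewrite ?inE cast_ordKV enum_rankK //.
Qed.

Lemma orbit_nonempty (A : posmx n r) : exists f f' : flag k n r, in_orbit A f f'.
Proof.
have [lab labP] := labelling A.
exists (Flag (is_flag_coord (fun x => (lab x).1))).
exists (Flag (is_flag_coord (fun x => (lab x).2))).
apply/in_orbitP => a b; rewrite /= !ffunE coord_spaceI dim_coord_space.
rewrite (_ : _ :&: _ = [set x | ((lab x).1 < a)%N && ((lab x).2 < b)%N]); last first.
  by apply/setP => x; rewrite !inE.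
by rewrite (labP (fun p => (p.1 < a)%N && (p.2 < b)%N)) /rk pair_big.
Qed.

(** Two flags with the same dimensions are conjugate, so the second flag of a
    pair in e_A can be made the first flag of a pair in e_B. *)
Lemma orbit_prod_nonempty (A B : posmx n r) : composable (natmx A) (natmx B) ->
  exists f1 f f2 : flag k n r, in_orbit A f1 f /\ in_orbit B f f2.
Proof.
move=> /composableP AB.
have [f1 [f oA]] := orbit_nonempty A; have [f' [f2 oB]] := orbit_nonempty B.
have [_ dA] := in_orbit_dim oA; have [dB _] := in_orbit_dim oB.
have : relpos f' f' = relpos f f.
  apply/relposP => a b; rewrite -dim_cap.
  have [ab|/ltnW ba] := leqP a b.
    by rewrite !(capv_idPl (flag_mono _ ab)) dA dB AB.
  by rewrite !(capv_idPr (flag_mono _ ba)) dA dB AB.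
move=> /same_relpos_act[G uG [Gf _]].
by exists f1, f, (flag_act G f2); rewrite -{2}Gf in_orbit_act.
Qed.

Lemma orbit_prod_composable (A B : posmx n r) (f1 f2 : flag k n r) :
  orbit_prod A B f1 f2 -> composable (natmx A) (natmx B).
Proof.
move=> [f [/in_orbit_dim[_ dA] /in_orbit_dim[dB _]]].
by apply/composableP => m; rewrite -dA -dB.
Qed.

(** The sum of the two intersections on the left is contained in [f m], and
    their intersection is contained in [f1 a] and [f2 b]. *)
Lemma dim_cap_triangle f1 f f2 (a m b : 'I_n.+1) :
  (\dim (f1 a :&: f m) + \dim (f m :&: f2 b)
   <= \dim (f1 a :&: f2 b) + \dim (f m))%N.
Proof.
rewrite -dimv_sum_cap addnC leq_add //.
  apply: dimvS; rewrite subv_cap (subv_trans (capvSl _ _) (capvSl _ _)).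
  exact: subv_trans (capvSr _ _) (capvSr _ _).
by apply: dimvS; rewrite subv_add capvSr capvSl.
Qed.

End FlagOrbits.

(** * Subspaces in general position *)

Section GenericSubspace.
Variables (k : fieldType) (vT : vectType k).
Implicit Types U V W X Y : {vspace vT}.

Lemma avoid_two Y U V : ~~ (Y <= U)%VS -> ~~ (Y <= V)%VS ->
  exists x, [/\ x \in Y, x \notin U & x \notin V].
Proof.
move=> /subvPn[u uY uU] /subvPn[v vY vV].
have [uV|uV] := boolP (u \in V); last by exists u.
have [vU|vU] := boolP (v \in U); last by exists v.
exists (u + v)%R; split; first by rewrite memvD.
  by rewrite rpredDr.
by rewrite rpredDl.
Qed.

Lemma dim_add_line V x : x \notin V -> \dim (V + <[x]>) = (\dim V).+1.
Proof.
move=> xV; rewrite dimv_disjoint_sum ?dim_vline.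
  by rewrite (_ : x != 0)%R ?addn1 //; apply: contraNneq xV => ->; rewrite mem0v.
apply/eqP; rewrite -subv0; apply/subvP => y; rewrite memv_cap memv0.
move=> /andP[yV /vlineP[c ey]]; have [c0|c0] := eqVneq c 0%R.
  by rewrite ey c0 scale0r.
by case/negP: xV; rewrite -[x](scalerK c0) -ey memvZ.
Qed.

(** New vectors are chosen one at a time in [Y], outside of [X + W], and
    outside of [U + W] for as long as that is possible. Once [Y] is contained
    in [U + W], the dimension of the intersection with [U] is the least
    possible. *)
Lemma extend_generic X Y U W s :
    (X <= Y)%VS -> (W <= Y)%VS -> \dim (X + W) + s <= \dim Y ->
  exists W' : {vspace vT},
    [/\ (W <= W')%VS, (W' <= Y)%VS, \dim W' = \dim W + s, (W' :&: X = W :&: X)%VS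
      & \dim (U :&: W') <= \dim (U :&: W) \/
        \dim (U :&: W') + \dim Y <= \dim (U :&: Y) + \dim W'].
Proof.
move=> XY WY; elim: s => [_|s IHs les].
  by exists W; split; rewrite ?subvv ?addn0 //; left.
have [|W1 [WW1 W1Y dW1 W1X leU]] := IHs; first lia.
have nYX : ~~ (Y <= X + W1)%VS.
  apply/negP => /dimvS; have := dimv_sum_cap X W1; have := dimv_sum_cap X W.
  by rewrite ![(X :&: _)%VS]capvC W1X; lia.
suff [x [xY xX xU]] : exists x, [/\ x \in Y, x \notin (X + W1)%VS &
    (Y <= U + W1)%VS || (x \notin (U + W1)%VS)].
  have xW1 : x \notin W1 by apply: contra xX => /(subvP (addvSr X W1)).
  exists (W1 + <[x]>)%VS.
  have dW' := dim_add_line xW1.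
  have W'Y : (W1 + <[x]> <= Y)%VS by rewrite subv_add W1Y -memvE.
  split=> //.
  - exact: subv_trans (addvSl _ _).
  - by rewrite dW' dW1 addnS.
  - rewrite -W1X; apply/esym/eqP; rewrite eqEdim capvS ?addvSl //=.
    have := dimv_sum_cap X W1; have := dimv_sum_cap X (W1 + <[x]>)%VS.
    rewrite addvA dim_add_line // dW' [(X :&: _)%VS]capvC [(X :&: W1)%VS]capvC.
    by lia.
  have := dimv_sum_cap U W1; have := dimv_sum_cap U (W1 + <[x]>)%VS.
  rewrite addvA; case/orP: xU => [YU|xU]; last first.
    by rewrite dim_add_line // dW' => e1 e2; case: leU => ?; [left|right]; lia.
  rewrite (addv_idPl _) ?dW' -?memvE ?(subvP YU) // => e1 e2; right.
  have eY : (W1 + (U :&: Y) = Y)%VS.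
    by rewrite vspace_modl // addvC; apply/capv_idPr.
  have := dimv_sum_cap W1 (U :&: Y)%VS; rewrite eY.
  rewrite (_ : W1 :&: (U :&: Y) = U :&: W1)%VS; first lia.
  by rewrite capvA (capvC W1) -capvA (capv_idPl W1Y).
have [YU|YU] := boolP (Y <= U + W1)%VS.
  by have /subvPn[x xY xX] := nYX; exists x.
by have [x [xY xX xU]] := avoid_two nYX YU; exists x.
Qed.

End GenericSubspace.

Section GenericPair.
Variables (k : fieldType) (n r : nat).
Implicit Types (f h : flag k n r) (U W : {vspace 'rV[k]_r}).

(** [W] is built along the flag. The last step at which a new vector had to be
    taken in [U + W] is the place where the bound holds; if there is none, [W]
    does not meet [U] and the place is 0. *)
Lemma generic_subspace f U (beta : nat -> nat) :
    beta 0 = 0 ->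
    (forall i : 'I_n, beta i <= beta i.+1) ->
    (forall i : 'I_n, beta i.+1 + \dim (f (lo i)) <= beta i + \dim (f (hi i))) ->
  exists W, (forall m : 'I_n.+1, \dim (f m :&: W) = beta m) /\
    exists m : 'I_n.+1,
      \dim (U :&: W) + \dim (f m) <= \dim (U :&: f m) + beta m.
Proof.
move=> b0 bmono bstep.
suff H : forall m : 'I_n.+1, exists W : {vspace 'rV[k]_r}, [/\ (W <= f m)%VS,
    forall l : 'I_n.+1, l <= m -> \dim (f l :&: W) = beta l
  & exists l : 'I_n.+1, \dim (U :&: W) + \dim (f l) <= \dim (U :&: f l) + beta l].
  have [W [_ dW leW]] := H ord_max; exists W; split=> // m.
  by apply: dW; rewrite -ltnS.
case=> m; elim: m => [|m IHm] ltm.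
  exists 0%VS; rewrite sub0v; split=> // [l|].
    by rewrite leqn0 => /eqP ->; rewrite capv0 dimv0 b0.
  exists ord0; rewrite flag0 !capv0 dimv0 b0 //.
pose i : 'I_n := Ordinal (ltm : m < n).
have elo : Ordinal (ltnW ltm) = lo i by apply: val_inj.
have ehi : Ordinal ltm = hi i by apply: val_inj; rewrite [RHS]hiE.
have [W [WX dW [l0 leW]]] := IHm (ltnW ltm).
rewrite ehi; rewrite elo in WX dW.
have XY := flag_step f i.
have dWi : \dim W = beta i.
  by rewrite -(dW (lo i)) //; congr (\dim _); apply/esym/capv_idPr.
have [||W' [WW' W'Y dW' W'X leU]] :=
  @extend_generic _ _ (f (lo i)) (f (hi i)) U W (beta i.+1 - beta i) XY.
- exact: subv_trans WX XY.
- by rewrite (addv_idPl WX); have := bstep i; have := bmono i; lia.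
have dWS : \dim W' = beta i.+1 by have := bmono i; lia.
exists W'; split=> // [l|].
  rewrite hiE leq_eqVlt => /predU1P[el|ltl].
    have -> : l = hi i by apply: val_inj; rewrite [LHS]el -hiE.
    by rewrite (capv_idPr W'Y) dWS hiE.
  rewrite -(dW l) //; congr (\dim _).
  by rewrite -(capv_idPl (flag_mono f (ltl : l <= lo i))) -!capvA
    ![(f (lo i) :&: _)%VS]capvC W'X.
case: leU => leU; first by exists l0; lia.
by exists (hi i); rewrite hiE -dWS.
Qed.

Lemma is_flag_line W : 1 < n ->
  is_flag [ffun j : 'I_n.+1 =>
    if j == 0 :> nat then 0%VS else if j == 1 :> nat then W else fullv].
Proof.
move=> n_gt1; apply/and3P; split; rewrite ?ffunE //=.
  by rewrite !gtn_eqF // ltnW.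
apply/forallP => i; rewrite !ffunE hiE /=.
by case: (nat_of_ord i) => [|m] /=; rewrite ?sub0v ?subvf.
Qed.

(** The flag 0, [W], V turns the position of [W] with respect to [f] into a
    relative position of two flags, to which transitivity applies. *)
Lemma conjugate_space f f' W W' : 1 < n ->
    (forall m, \dim (f m :&: W) = \dim (f' m :&: W')) ->
    (forall m, \dim (f m) = \dim (f' m)) ->
  exists2 G, G \in unitmx & flag_act G f = f' /\ act G W = W'.
Proof.
(* [b] is the place of [W] in the flag 0, [W], V. *)
move=> n_gt1 dW df; pose b : 'I_n.+1 := Ordinal (ltnW n_gt1 : 1 < n.+1).
pose p := Flag (is_flag_line W n_gt1); pose p' := Flag (is_flag_line W' n_gt1).
have [|G uG [Gf Gp]] := @same_relpos_act k n r f p f' p'.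
  apply/relposP => a c; rewrite -dim_cap /= !ffunE.
  case: ifP => _; first by rewrite !capv0 dimv0.
  by case: ifP => _; rewrite ?capvf.
by exists G => //; split=> //; have := flag_actE p b uG; rewrite Gp /= !ffunE.
Qed.

(** Given (f1, f) in e_A, a space in general position with [f1 a] is the
    [b]-th space of some [f2] with (f, f2) in e_B: conjugate any such flag by
    the stabiliser of [f]. *)
Lemma generic_pair (A B : posmx n r) (a b : 'I_n.+1) :
    composable (natmx A) (natmx B) ->
  exists f1 f f2 : flag k n r, [/\ in_orbit A f1 f, in_orbit B f f2 &
    exists m : 'I_n.+1, \dim (f1 a :&: f2 b) + rk (natmx A) n m
      <= rk (natmx A) a m + rk (natmx B) m b].
Proof.
move=> AB; have [f1 [f [f2 [oA oB]]]] := orbit_prod_nonempty k AB.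
have [[dA1 dA] [dB dB2]] := (in_orbit_dim oA, in_orbit_dim oB).
have /in_orbitP cA := oA; have /in_orbitP cB := oB.
case: (eqVneq b ord0) => [-> | b0].
  by exists f1, f, f2; split=> //; exists ord0; rewrite flag0 capv0 dimv0 !rk0r.
case: (eqVneq b ord_max) => [-> | bm].
  exists f1, f, f2; split=> //; exists ord_max; rewrite flag_max capvf dA1 /=.
  by have := dB ord_max; rewrite dA /= => ->.
have n_gt1 : 1 < n.
  by move: b0 bm (ltn_ord b); rewrite -!val_eqE /=; lia.
have [|i|i|W [dW [m leW]]] := @generic_subspace f (f1 a) (fun m => rk (natmx B) m b).
- exact: rk0l.
- exact: rk_mono.
- rewrite !dB hiE addnC.
  by have := rk_super (natmx B) (leqnSn i) (ltn_ord b : b <= n); rewrite /=; lia.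
(* [generic_subspace] gives [W] the dimensions that [f2 b] has along [f]. *)
have [//|m'||G uG [Gf GW]] := @conjugate_space f f (f2 b) W; rewrite ?dW //.
exists f1, f, (flag_act G f2); split=> //; first by rewrite -{1}Gf in_orbit_act.
by exists m; rewrite flag_actE // GW -dA -cA.
Qed.

End GenericPair.

(** * Pluecker coordinates and multihomogeneous polynomials *)

Section Minors.
Variables (k : fieldType) (r : nat).
Implicit Types U W : {vspace 'rV[k]_r}.
Local Open Scope ring_scope.

Definition basis_mx m W : 'M[k]_(m, r) := \matrix_(a, j) (vbasis W)`_a 0 j.

Lemma mem_basis_mx m W v : m = \dim W -> (v \in W) = (v <= basis_mx m W)%MS.
Proof.
move=> ->; have rowE a : row a (basis_mx (\dim W) W) = (vbasis W)`_a.
  by apply/rowP => j; rewrite !mxE.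
apply/idP/submxP => [vW|[u ->]].
  exists (\row_i coord (vbasis W) i v); rewrite mulmx_sum_row {1}(coord_vbasis vW).
  by apply: eq_bigr => i _; rewrite mxE rowE.
rewrite mulmx_sum_row; apply: memv_suml => i _; rewrite memvZ // rowE.
by rewrite vbasis_mem // mem_nth ?size_tuple.
Qed.

Lemma row_free_basis_mx m W : m = \dim W -> row_free (basis_mx m W).
Proof.
move=> ->; rewrite -kermx_eq0; apply/eqP/row_matrixP => i; rewrite row0.
set u := row i _; have uW : u *m basis_mx (\dim W) W = 0.
  by rewrite /u -row_mul mulmx_ker row0.
have /freeP fW := basis_free (vbasisP W).
apply/rowP => j; rewrite [RHS]mxE; apply: (fW (fun j => u 0 j)).
move: uW; rewrite mulmx_sum_row => uW; rewrite -[RHS]uW.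
by apply: eq_bigr => l _; congr (_ *: _); apply/rowP => j'; rewrite !mxE.
Qed.

Lemma plueckerE W J : pluecker W J =
  if #|J| == \dim W then \det (colsub enum_val (basis_mx #|J| W)) else 0.
Proof.
rewrite /pluecker; case: ifP => // _; congr (\det _).
by apply/matrixP => a b; rewrite !mxE.
Qed.

(** Two bases differ by an invertible matrix, which multiplies all the maximal
    minors by its determinant. *)
Lemma pluecker_basis m W (M : 'M[k]_(m, r)) : m = \dim W ->
    row_free M -> (forall i, row i M \in W) ->
  exists2 c : k, c != 0 &
    forall phi : 'I_m -> 'I_r,
      \det (colsub phi M) = c * \det (colsub phi (basis_mx m W)).
Proof.
move=> dW freeM MW.
have /submxP[T eM] : (M <= basis_mx m W)%MS.
  by apply/row_subP => i; rewrite -mem_basis_mx.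
have uT : T \in unitmx.
  rewrite -row_free_unit -row_leq_rank -{1}(eqP freeM) eM.
  exact: mxrankM_maxl.
exists (\det T); first by rewrite -unitfE.
by move=> phi; rewrite -det_mulmx eM mulmx_colsub.
Qed.

(** Two enumerations of the same columns differ by a permutation. The entries
    are given by a function of natural numbers since the sizes of the two
    minors are only propositionally equal. *)
Lemma minor_perm m d (phi : 'I_d -> 'I_r) (psi : 'I_m -> 'I_r) :
    d = m -> injective phi -> (forall x, exists y, phi x = psi y) ->
  exists c : k, forall F : nat -> 'I_r -> k,
    \det (\matrix_(a, b) F a (phi b)) = c * \det (\matrix_(a, b) F a (psi b)).
Proof.
move=> dm; case: _ / dm psi => psi phi_inj /choice[s sP].
have s_inj : injective s.
  by move=> x y sxy; apply: phi_inj; rewrite !sP sxy.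
exists ((-1) ^+ perm s_inj) => F.
rewrite (_ : \matrix_(a, b) F a (phi b)
    = col_perm (perm s_inj) (\matrix_(a, b) F a (psi b))).
  by rewrite col_permE det_mulmx det_perm mulrC odd_permV.
by apply/matrixP => a b; rewrite !mxE permE sP.
Qed.

(** A repeated column costs a factor zero and a list of columns out of order
    costs a sign, neither of which depends on the subspace. *)
Lemma minor_pluecker d (phi : 'I_d -> 'I_r) :
  exists (J : {set 'I_r}) (c : k), forall W, \dim W = d ->
    \det (colsub phi (basis_mx d W)) = c * pluecker W J.
Proof.
have [phi_inj|] := boolP (injectiveb phi).
  have {}phi_inj := injectiveP _ phi_inj.
  pose J := [set phi x | x in 'I_d].
  have cJ : d = #|J| by rewrite card_imset // card_ord.
  have [|c cP] := minor_perm (psi := @enum_val _ (mem J)) cJ phi_inj.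
    move=> x; have xJ : phi x \in J by apply: imset_f.
    by exists (enum_rank_in xJ (phi x)); rewrite enum_rankK_in.
  exists J, c => W dW; rewrite plueckerE ifT; last by rewrite dW -cJ.
  have := cP (fun a j => (vbasis W)`_a 0 j) => /= E.
  rewrite (_ : colsub phi _ = \matrix_(a, b) (vbasis W)`_a 0 (phi b)) ?E.
    by congr (_ * \det _); apply/matrixP => a b; rewrite !mxE.
  by apply/matrixP => a b; rewrite !mxE.
move=> /injectivePn[x [y xy exy]]; exists set0, 0 => W _.
rewrite mul0r -det_tr; apply: (determinant_alternate xy) => a.
by rewrite !mxE exy.
Qed.

Definition subst_col d (phi : 'I_d -> 'I_r) i j : 'I_d -> 'I_r :=
  fun x => if x == i then j else phi x.

(** Cramer's rule. It makes vectors of the subspace out of minors of a basis,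
    which are linear in the Pluecker coordinates. *)
Lemma minors_adj d (phi : 'I_d -> 'I_r) (M : 'M[k]_(d, r)) :
  \matrix_(i, j) \det (colsub (subst_col phi i j) M)
  = \adj (colsub phi M) *m M.
Proof.
apply/matrixP => i j; rewrite !mxE (expand_det_col _ i); apply: eq_bigr => l _.
rewrite [X in X * _ = _]mxE /subst_col eqxx [in RHS]mxE mulrC; congr (_ * _).
rewrite /cofactor; congr (_ * \det _); apply/matrixP => a b; rewrite !mxE.
by rewrite [lift _ _ == _]eq_sym (negPf (neq_lift _ _)).
Qed.

(** These vectors span the subspace, since the adjugate is invertible. *)
Lemma minors_span d (phi : 'I_d -> 'I_r) (M : 'M[k]_(d, r)) :
  \det (colsub phi M) != 0 -> (M <= \adj (colsub phi M) *m M)%MS.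
Proof.
move=> d0; apply/submxP; exists ((\det (colsub phi M))^-1 *: colsub phi M).
by rewrite mulmxA -scalemxAl mul_mx_adj scale_scalar_mx mulVf // mul1mx.
Qed.

Lemma row_free_minor d (M : 'M[k]_(d, r)) : row_free M ->
  exists phi : 'I_d -> 'I_r, \det (colsub phi M) != 0.
Proof.
move=> freeM; have fullM : row_full M^T by rewrite /row_full mxrank_tr.
exists (fullrankfun fullM); rewrite -det_tr trmx_mxsub -unitfE.
exact: (fullrowsub_unit fullM).
Qed.

End Minors.

Section Multihomogeneous.
Variables (k : fieldType) (n r : nat).
Local Open Scope ring_scope.
Local Notation poly := (coord_poly k n r).
Implicit Types (p q : poly) (d : bool -> 'I_n.+1 -> nat).

(** The degree of a monomial in the coordinates of the [i]-th space of one of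
    the two flags. *)
Definition multidegree (m : 'X_{1..#|coord_index n r|}) s i : nat :=
  (\sum_(J : {set 'I_r}) m (enum_rank ((s, i, J) : coord_index n r)))%N.

Definition mhomog d p : Prop :=
  forall m, m \in msupp p -> forall s i, multidegree m s i = d s i.

Lemma mhomog_multihomogeneous d p : mhomog d p -> multihomogeneous p.
Proof. by exists d. Qed.

Lemma mhomogM d d' p q : mhomog d p -> mhomog d' q ->
  mhomog (fun s i => d s i + d' s i)%N (p * q).
Proof.
move=> hp hq m /msuppM_le /allpairsP[[m1 m2] /= [m1p m2q ->]] s i.
rewrite -(hp m1) // -(hq m2) // -big_split; apply: eq_bigr => J _.
by rewrite /= mnmDE.
Qed.

Lemma mhomog_sum d (I : finType) (P : pred I) (F : I -> poly) :
  (forall i, P i -> mhomog d (F i)) -> mhomog d (\sum_(i | P i) F i).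
Proof.
move=> hF m /msupp_sum_le /flattenP[s /mapP[i]].
by rewrite mem_filter => /andP[Pi _] -> mF; apply: hF mF.
Qed.

Lemma mhomogZ d c p : mhomog d p -> mhomog d (c *: p).
Proof. by move=> hp m /msuppZ_le; apply: hp. Qed.

Lemma mhomog1 : mhomog (fun _ _ => 0%N) (1 : poly).
Proof.
move=> m; rewrite msupp1 inE => /eqP-> s i.
by rewrite /multidegree big1 // => J _; rewrite mnm0E.
Qed.

Lemma mhomog_ext d d' p : (forall s i, d s i = d' s i) -> mhomog d p -> mhomog d' p.
Proof. by move=> dd' hp m mp s i; rewrite hp. Qed.

Lemma mhomog_prod (I : Type) (t : seq I) (D : I -> bool -> 'I_n.+1 -> nat)
    (F : I -> poly) :
  (forall i, mhomog (D i) (F i)) ->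
  mhomog (fun s a => \sum_(i <- t) D i s a)%N (\prod_(i <- t) F i).
Proof.
move=> hF; elim: t => [|i t IHt].
  by rewrite big_nil; apply: mhomog_ext mhomog1 => s a; rewrite big_nil.
rewrite big_cons; apply: mhomog_ext (mhomogM (hF i) IHt) => s a.
by rewrite big_cons.
Qed.

Lemma mhomog_det m (D : 'I_m -> bool -> 'I_n.+1 -> nat) (P : 'M[poly]_m) :
    (forall i j, mhomog (D i) (P i j)) ->
  mhomog (fun s a => \sum_i D i s a)%N (\det P).
Proof.
move=> hP; apply: mhomog_sum => s _.
have := @mhomog_prod _ (index_enum 'I_m) _ _ (fun i => hP i (s i)).
case: (odd_perm s); rewrite ?expr1 ?expr0 ?mul1r // mulN1r -scaleN1r.
exact: mhomogZ.
Qed.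

Definition slot_degree (s : bool) (a : 'I_n.+1) : bool -> 'I_n.+1 -> nat :=
  fun s' a' => (s == s') && (a == a').

Lemma mhomogX s a J :
  mhomog (slot_degree s a) ('X_(enum_rank ((s, a, J) : coord_index n r)) : poly).
Proof.
move=> m; rewrite msuppX inE => /eqP -> s' a'; rewrite /multidegree /slot_degree.
rewrite (bigD1 J) //= big1 ?addn0; last first.
  move=> J' J'J; rewrite mnmE; case: eqP => // /enum_rank_inj [_ _ eJ].
  by rewrite eJ eqxx in J'J.
rewrite mnmE (inj_eq enum_rank_inj) !xpair_eqE eqxx andbT.
by rewrite andbC.
Qed.

(** Rescaling the coordinates of each space multiplies all monomials by the
    same factor. *)
Lemma mhomog_scale d p (c : bool -> 'I_n.+1 -> k) (v w : coord_index n r -> k) :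
    mhomog d p -> (forall s a J, w (s, a, J) = c s a * v (s, a, J)) ->
  p.@[fun x => w (enum_val x)]
  = (\prod_s \prod_a c s a ^+ d s a) * p.@[fun x => v (enum_val x)].
Proof.
move=> hp wE; rewrite !mevalE mulr_sumr; apply: eq_big_seq => m mp.
rewrite mulrCA; congr (_ * _).
have reidx (F : coord_index n r -> k) :
    \prod_(x < #|coord_index n r|) F (enum_val x)
    = \prod_s \prod_a \prod_J F (s, a, J).
  rewrite (reindex (@enum_rank _)) /=; last first.
    by exists enum_val => x _; [exact: enum_rankK | exact: enum_valK].
  under eq_bigr do rewrite enum_rankK.
  rewrite (pair_big xpredT xpredT) /= (pair_big xpredT xpredT) /=.
  by apply: eq_bigr => -[[s a] J].
have mE x : m x = m (enum_rank (enum_val x)) by rewrite enum_valK.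
under eq_bigr do rewrite mE.
under [X in _ = _ * X]eq_bigr do rewrite mE.
rewrite (reidx (fun x => w x ^+ m (enum_rank x))).
rewrite (reidx (fun x => v x ^+ m (enum_rank x))).
rewrite -big_split; apply: eq_bigr => s _ /=.
rewrite -big_split; apply: eq_bigr => a _ /=.
rewrite -(hp m mp) /multidegree -prodrXr -big_split.
by apply: eq_bigr => J _ /=; rewrite wE exprMn.
Qed.

End Multihomogeneous.

(** * Semicontinuity and irreducibility *)

Section Separators.
Variables (k : fieldType) (n r : nat).
Local Open Scope ring_scope.
Local Notation poly := (coord_poly k n r).
Implicit Types (p q : poly) (f h : flag k n r).

Definition eval_flags q f f' : k := q.@[fun x => coords f f' (enum_val x)].

Lemma minor_polynomials s (a : 'I_n.+1) d (phi : 'I_d -> 'I_r) :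
  exists P : 'M[poly]_(d, r), (forall i j, mhomog (slot_degree s a) (P i j)) /\
    forall h h', \dim ((if s then h' else h) a) = d ->
      map_mx (fun q => eval_flags q h h') P
      = \adj (colsub phi (basis_mx d ((if s then h' else h) a)))
        *m basis_mx d ((if s then h' else h) a).
Proof.
have /choice[F FP] (ij : 'I_d * 'I_r) : exists q : poly,
    mhomog (slot_degree s a) q /\
    forall h h', \dim ((if s then h' else h) a) = d -> eval_flags q h h'
      = \det (colsub (subst_col phi ij.1 ij.2)
                     (basis_mx d ((if s then h' else h) a))).
  have [J [c cP]] := minor_pluecker k (subst_col phi ij.1 ij.2).
  exists (c *: 'X_(enum_rank ((s, a, J) : coord_index n r))); split.
    exact/mhomogZ/mhomogX.
  by move=> h h' dh; rewrite /eval_flags mevalZ mevalXU enum_rankK cP.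
exists (\matrix_(i, j) F (i, j)); split=> [i j|h h' dh].
  by rewrite mxE; case: (FP (i, j)).
rewrite -minors_adj; apply/matrixP => i j; rewrite !mxE.
by case: (FP (i, j)) => _ ->.
Qed.

(** The dimension of an intersection is upper semicontinuous. The minors of a
    matrix whose rows span the sum of the two spaces are multihomogeneous
    polynomials in the Pluecker coordinates; one of maximal size does not
    vanish at (f, f'), and it vanishes wherever the sum is smaller. *)
Lemma separator f f' (a b : 'I_n.+1) :
  exists q, [/\ multihomogeneous q, eval_flags q f f' != 0 &
    forall h h', \dim (h a) = \dim (f a) -> \dim (h' b) = \dim (f' b) ->
      (\dim (f a :&: f' b) < \dim (h a :&: h' b))%N -> eval_flags q h h' = 0].
Proof.
have [phi phi0] := row_free_minor (row_free_basis_mx (erefl (\dim (f a)))).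
have [phi' phi0'] := row_free_minor (row_free_basis_mx (erefl (\dim (f' b)))).
have [P [hP PE]] := minor_polynomials false a phi.
have [P' [hP' PE']] := minor_polynomials true b phi'.
pose S h h' := map_mx (fun q => eval_flags q h h') (col_mx P P').
have leS : (\dim (f a + f' b)%VS <= \rank (S f f'))%N.
  have <- := eqP (row_free_basis_mx (erefl (\dim (f a + f' b)%VS))).
  apply/mxrankS/row_subP => i; rewrite /S map_col_mx PE // PE' //= -addsmxE.
  have : row i (basis_mx _ (f a + f' b)%VS) \in (f a + f' b)%VS.
    by rewrite (mem_basis_mx _ (erefl _)) row_sub.
  case/memv_addP => u uU [w wW ->]; apply: addmx_sub_adds.
    rewrite (mem_basis_mx _ (erefl _)) in uU.
    exact: submx_trans uU (minors_span phi0).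
  rewrite (mem_basis_mx _ (erefl _)) in wW.
  exact: submx_trans wW (minors_span phi0').
have geS h h' : \dim (h a) = \dim (f a) -> \dim (h' b) = \dim (f' b) ->
    (\rank (S h h') <= \dim (h a + h' b)%VS)%N.
  move=> dh dh'; apply: leq_trans (rank_leq_row (basis_mx _ (h a + h' b)%VS)).
  apply: mxrankS; rewrite /S map_col_mx PE // PE' // -addsmxE addsmx_sub.
  apply/andP; split; apply/row_subP => i; rewrite row_mul.
    apply: (submx_trans (submxMl _ _)); apply/row_subP => l.
    rewrite -mem_basis_mx // (subvP (addvSl _ _)) //.
    by rewrite (mem_basis_mx _ (esym dh)) row_sub.
  apply: (submx_trans (submxMl _ _)); apply/row_subP => l.
  rewrite -mem_basis_mx // (subvP (addvSr _ _)) //.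
  by rewrite (mem_basis_mx _ (esym dh')) row_sub.
pose R := \rank (S f f').
pose rho := maxrankfun (S f f').
have [kappa kappa0] := row_free_minor (maxrowsub_free (S f f')).
pose q := \det (mxsub rho kappa (col_mx P P')).
have qE h h' : eval_flags q h h' = \det (mxsub rho kappa (S h h')).
  rewrite /eval_flags /q -det_map_mx; congr (\det _).
  by apply/matrixP => i j; rewrite !mxE.
exists q; split.
- pose D (i : 'I_(\dim (f a) + \dim (f' b))) :=
    if split i is inl _ then slot_degree false a else slot_degree true b.
  apply: (@mhomog_multihomogeneous _ _ _
    (fun s c => \sum_(i < R) D (rho i) s c)%N).
  apply: mhomog_det => i j; rewrite mxE /D mxE.
  by case: splitP => l _.
- rewrite qE (_ : mxsub _ _ _ = colsub kappa (rowsub rho (S f f'))) //.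
  by apply/matrixP => i j; rewrite !mxE.
move=> h h' dh dh' lt; rewrite qE; apply/eqP; rewrite -[_ == 0]negbK -unitfE.
rewrite -unitmxE -row_free_unit /row_free neq_ltn; apply/orP; left.
have : (\rank (mxsub rho kappa (S h h')) <= \rank (S h h'))%N.
  rewrite -[S h h']mulmx1 mxsub_mul -[X in (_ <= X)%N]mxrank_tr.
  apply: leq_trans (mxrankM_maxl _ _) _; rewrite mxrank_tr mulmx1 rowsubE.
  exact: mxrankM_maxr.
have := geS _ _ dh dh'; have := dimv_sum_cap (h a) (h' b).
by have := dimv_sum_cap (f a) (f' b); rewrite dh dh' /=; lia.
Qed.

End Separators.

Section Irreducibility.
Variables (k : closedFieldType) (n r : nat).
Local Open Scope ring_scope.
Implicit Types (p q : coord_poly k n r) (f h : flag k n r).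
Local Notation at_ t := (map_mx (fun P : {poly k} => P.[t])).

(** If [P] is not constant, a root of [P - 1] will do. *)
Lemma nonroot (P : {poly k}) : P != 0 -> exists t, P.[t] != 0.
Proof.
move=> P0; have [s1|s1] := boolP (size (P - 1) == 1%N).
  exists 0; have [c c0 Pc] := size_poly1P _ s1.
  have eP : P = (c + 1)%:P by rewrite polyCD -Pc subrK.
  by rewrite eP hornerC; apply: contraNneq P0 => c1; rewrite eP c1.
have [t /rootP] := closed_rootP _ s1.
rewrite hornerD hornerN hornerC => /eqP; rewrite subr_eq0 => /eqP Pt.
by exists t; rewrite Pt oner_neq0.
Qed.

(** The images of a basis have coordinates, hence minors, that are polynomials
    in the parameter; the Pluecker coordinates of the images differ from these
    minors by a non-zero factor for each space. *)
Lemma eval_family d q f1 f2 (X1 X2 : 'M[{poly k}]_r) : mhomog d q ->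
  exists Q : {poly k}, forall t, at_ t X1 \in unitmx -> at_ t X2 \in unitmx ->
    exists2 c : k, c != 0 &
      Q.[t] = c * eval_flags q (flag_act (at_ t X1) f1) (flag_act (at_ t X2) f2).
Proof.
move=> hq; pose fs (s : bool) := if s then f2 else f1.
pose Xs (s : bool) := if s then X2 else X1.
pose w (x : coord_index n r) : {poly k} := let: (s, a, J) := x in
  if #|J| == \dim (fs s a) then
    \det (colsub enum_val (map_mx polyC (basis_mx #|J| (fs s a)) *m Xs s))
  else 0.
exists (\sum_(m <- msupp q) q@_m *: \prod_x w (enum_val x) ^+ m x) => t u1 u2.
have us s : at_ t (Xs s) \in unitmx by case: s.
have cP (u : bool * 'I_n.+1) : exists c : k, c != 0 /\ forall J,
    (w (u.1, u.2, J)).[t] = c * pluecker (act (at_ t (Xs u.1)) (fs u.1 u.2)) J.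
  case: u => s a /=; set W := fs s a; set G := at_ t _.
  have dW : \dim W = \dim (act G W) by rewrite dim_act // us.
  have [||c c0 cP] := pluecker_basis (M := basis_mx (\dim W) W *m G) dW.
  - rewrite /row_free mxrankMfree ?row_free_unit ?us //.
    exact: row_free_basis_mx.
  - move=> i; rewrite row_mul /act -[_ *m G](lfunE (mulmxr G)) memv_img //.
    by rewrite (mem_basis_mx _ (erefl _)) row_sub.
  exists c; split=> // J; rewrite plueckerE -dW; case: eqP => eJ; last first.
    by rewrite horner0 mulr0.
  rewrite -/(horner_eval t _) -det_map_mx map_mxsub map_mxM -map_mx_comp.
  move: (@enum_val _ _) => phi; move: (#|J|) eJ phi => m -> phi.
  rewrite -cP; congr (\det (colsub _ (_ *m _))).
  by apply/matrixP => i j; rewrite !mxE /= /horner_eval hornerC.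
have {cP}/choice[c cP] := cP.
exists (\prod_s \prod_a c (s, a) ^+ d s a).
  by apply/prodf_neq0 => s _; apply/prodf_neq0 => a _; rewrite expf_neq0 ?(cP _).1.
rewrite /eval_flags; apply: etrans (mhomog_scale (c := fun s a => c (s, a))
  (w := fun x => (w x).[t]) hq _); last first.
  by move=> s a J; rewrite (cP (s, a)).2 /=; case: s; rewrite flag_actE.
rewrite mevalE horner_sum; apply: eq_bigr => m _.
rewrite hornerZ horner_prod; congr (_ * _); apply: eq_bigr => x _.
by rewrite horner_exp.
Qed.

Definition path_to (G : 'M[k]_r) : 'M[{poly k}]_r :=
  (1 - 'X)%:M + 'X *: map_mx polyC G.

Lemma path_toE G t : at_ t (path_to G) = (1 - t)%:M + t *: G.
Proof.
apply/matrixP => i j; rewrite !mxE; case: (i == j) => /=;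
  by rewrite ?mulr1n ?mulr0n !(hornerE, hornerMX) mulrC.
Qed.

(** S(A, B) is the image of the pairs of an invertible matrix and an
    invertible matrix that stabilises a given flag, by (G, U) |-> (G f1, G U
    f2). Two such pairs are joined by a line, along which all conditions are
    the non-vanishing of polynomials in one variable. *)
Lemma irreducible (A B : posmx n r) q q' f1 f2 f1' f2' :
    multihomogeneous q -> multihomogeneous q' ->
    orbit_prod A B f1 f2 -> orbit_prod A B f1' f2' ->
    eval_flags q f1 f2 != 0 -> eval_flags q' f1' f2' != 0 ->
  exists h1 h2 : flag k n r, [/\ orbit_prod A B h1 h2,
    eval_flags q h1 h2 != 0 & eval_flags q' h1 h2 != 0].
Proof.
move=> [d hq] [d' hq'] [f [oA oB]] [f' [oA' oB']] q0 q1.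
have [|G uG [G1 Gf]] := @same_relpos_act _ _ _ f1 f f1' f'.
  by rewrite (eqP oA) (eqP oA').
have [|H uH [Hf H2]] := @same_relpos_act _ _ _ f f2 f' f2'.
  by rewrite (eqP oB) (eqP oB').
(* Both [G] and [H] map [f] to [f'], so [U] stabilises [f], and (f1', f2') is
   the image under [G] of (f1, f2 U). *)
pose U := H *m invmx G.
have uU : U \in unitmx by rewrite unitmx_mul uH unitmx_inv.
have Uf : flag_act U f = f.
  rewrite flag_actM ?unitmx_inv // Hf -Gf -flag_actM ?unitmx_inv //.
  by rewrite mulmxV // flag_act1.
pose X1 := path_to G; pose X2 := path_to U *m path_to G.
have [Q QP] := eval_family f1 f2 X1 X2 hq.
have [Q' QP'] := eval_family f1 f2 X1 X2 hq'.
have at_mul t : at_ t X2 = at_ t (path_to U) *m at_ t (path_to G).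
  exact: (map_mxM (horner_eval t)).
have at0 M : at_ 0 (path_to M) = 1%:M by rewrite path_toE subr0 scale0r addr0.
have at1 M : at_ 1 (path_to M) = M.
  by rewrite path_toE subrr scale1r raddf0 add0r.
have detE t M : at_ t M \in unitmx = ((\det M).[t] != 0).
  by rewrite unitmxE unitfE; congr (_ != _); exact: (det_map_mx (horner_eval t)).
have nz (P : {poly k}) t : P.[t] != 0 -> P != 0.
  by apply: contraNneq => ->; rewrite horner0.
(* The factors do not vanish at 0 or at 1, the parameters of the two given
   points. *)
have [t Dt] : exists t, (\det (path_to G) * \det (path_to U) * (Q * Q')).[t] != 0.
  apply: nonroot; rewrite !mulf_neq0 //.
  - by apply: (nz _ 0); rewrite -detE at0 unitmx1.
  - by apply: (nz _ 0); rewrite -detE at0 unitmx1.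
  - apply: (nz _ 0); have := QP 0; rewrite at_mul /X1 !at0 mulmx1 unitmx1.
    move=> /(_ isT isT)[c c0 ->]; by rewrite !flag_act1 mulf_neq0.
  apply: (nz _ 1); have := QP' 1; rewrite at_mul /X1 !at1 mulmxKV // uG uH.
  by move=> /(_ isT isT)[c c0 ->]; rewrite G1 H2 mulf_neq0.
move: Dt; rewrite !hornerM !mulf_eq0 !negb_or -!detE -andbA.
set g := at_ t (path_to G); set u := at_ t (path_to U) => /and4P[ug uu Qt Qt'].
have uX2 : at_ t X2 \in unitmx by rewrite at_mul unitmx_mul uu.
have uf : flag_act u f = f.
  apply: flag_ext => i; rewrite flag_actE //; apply/eqP.
  rewrite eqEdim dim_act // leqnn andbT; apply/subvP => _ /memv_imgP[v vf ->].
  have : v *m U \in f i.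
    rewrite -{1}Uf flag_actE // /act -[v *m U](lfunE (mulmxr U)).
    exact: memv_img.
  rewrite lfunE /= /u path_toE mulmxDr mul_mx_scalar -scalemxAr => vU.
  by rewrite memvD ?memvZ.
have [c _ Qc] := QP t ug uX2; have [c' _ Qc'] := QP' t ug uX2.
exists (flag_act g f1), (flag_act (at_ t X2) f2); split.
- exists (flag_act g f); rewrite in_orbit_act //; split=> //.
  by rewrite at_mul flag_actM // in_orbit_act // -{1}uf in_orbit_act.
- by move: Qt; rewrite Qc; apply: contraNneq => ->; rewrite mulr0.
- by move: Qt'; rewrite Qc'; apply: contraNneq => ->; rewrite mulr0.
Qed.

End Irreducibility.

(** * The open orbit is the tropical product *)

Section OpenOrbits.
Variables (k : closedFieldType) (n r : nat).
Implicit Types (q : coord_poly k n r) (A B C : posmx n r) (f h : flag k n r).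

Lemma multihomogeneous_prod (I : finType) (q : I -> coord_poly k n r) :
  (forall i, multihomogeneous (q i)) -> multihomogeneous (\prod_i q i)%R.
Proof.
move=> /choice[d hq]; apply: mhomog_multihomogeneous (mhomog_prod _).
exact: hq.
Qed.

Lemma eval_flags_prod (I : Type) (t : seq I) (q : I -> coord_poly k n r) f f' :
  eval_flags (\prod_(i <- t) q i)%R f f' = (\prod_(i <- t) eval_flags (q i) f f')%R.
Proof. exact: rmorph_prod. Qed.

Lemma irreducible_family A B (I : finType) (q : I -> coord_poly k n r) :
    (exists f1 f2, @orbit_prod n r k A B f1 f2) ->
    (forall i, multihomogeneous (q i)) ->
    (forall i, exists f1 f2, orbit_prod A B f1 f2 /\ eval_flags (q i) f1 f2 != 0%R) ->
  exists h1 h2, orbit_prod A B h1 h2 /\ forall i, eval_flags (q i) h1 h2 != 0%R.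
Proof.
move=> ne hq nz; suff [h1 [h2 [S12 H]]] : exists h1 h2, orbit_prod A B h1 h2 /\
    eval_flags (\prod_i q i)%R h1 h2 != 0%R.
  exists h1, h2; split=> // i; move: H; rewrite eval_flags_prod.
  by move=> /prodf_neq0; apply.
suff H (t : seq I) : multihomogeneous (\prod_(i <- t) q i)%R /\
    exists h1 h2, orbit_prod A B h1 h2 /\
      eval_flags (\prod_(i <- t) q i)%R h1 h2 != 0%R by have [_ ?] := H (index_enum I).
elim: t => [|i t [ht [h1 [h2 [S12 t0]]]]].
  have [f1 [f2 S12]] := ne; split.
    by rewrite big_nil; apply: mhomog_multihomogeneous (@mhomog1 _ _ _).
  by exists f1, f2; rewrite big_nil /eval_flags meval1 oner_neq0.
rewrite big_cons; split.
  have [[d hi] [d' {}ht]] := (hq i, ht).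
  exact: mhomog_multihomogeneous (mhomogM hi ht).
have [f1 [f2 [S' i0]]] := nz i.
have [g1 [g2 [S'' gi gt]]] := irreducible (hq i) ht S' S12 i0 t0.
exists g1, g2; split=> //; rewrite /eval_flags mevalM.
by rewrite mulf_neq0.
Qed.

Lemma orbit_prod_le A B C f1 f2 : orbit_prod A B f1 f2 -> in_orbit C f1 f2 ->
  [/\ forall a : 'I_n.+1, rk (natmx C) a n = rk (natmx A) a n,
      forall b : 'I_n.+1, rk (natmx C) n b = rk (natmx B) n b
    & forall a m b : 'I_n.+1, rk (natmx A) a m + rk (natmx B) m b
        <= rk (natmx C) a b + rk (natmx A) n m].
Proof.
move=> [f [oA oB]] oC.
have [dA1 dA] := in_orbit_dim oA; have [dB dB2] := in_orbit_dim oB.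
have [dC dC2] := in_orbit_dim oC.
split=> [a|b|a m b]; rewrite -?dC -?dC2 ?dA1 ?dB2 //.
move: oA oB oC => /in_orbitP cA /in_orbitP cB /in_orbitP cC.
by rewrite -cA -cB -cC -dA; apply: dim_cap_triangle.
Qed.

(** For each pair of spaces there is a point of S(A, B) where they are in
    general position, and a polynomial that does not vanish there. By
    irreducibility, none of these polynomials vanishes at some point, and
    there all the pairs of spaces are in general position. *)
Lemma generic_orbit A B : composable (natmx A) (natmx B) ->
  exists C, tropical (natmx A) (natmx B) (natmx C) /\
    exists f1 f2, @orbit_prod n r k A B f1 f2 /\ in_orbit C f1 f2.
Proof.
move=> AB.
have /choice[F FP] (u : 'I_n.+1 * 'I_n.+1) : exists x : flag k n r * flag k n r,
    orbit_prod A B x.1 x.2 /\ exists m : 'I_n.+1,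
      \dim (x.1 u.1 :&: x.2 u.2) + rk (natmx A) n m
      <= rk (natmx A) u.1 m + rk (natmx B) m u.2.
  have [f1 [f [f2 [oA oB [m le]]]]] := generic_pair k u.1 u.2 AB.
  by exists (f1, f2); split; [exists f | exists m].
have /choice[q qP] u := separator (F u).1 (F u).2 u.1 u.2.
have [||u|h1 [h2 [S12 h0]]] := @irreducible_family A B _ q.
- by have [S0 _] := FP (ord0, ord0); do 2!eexists; apply: S0.
- by move=> u; case: (qP u).
- by exists (F u).1, (F u).2; split; [case: (FP u) | case: (qP u)].
have [C oC] := in_orbit_relpos h1 h2; exists C; split; last by exists h1, h2.
have [rC cC leC] := orbit_prod_le S12 oC.
split=> // a b; have [S0 [m le]] := FP (a, b); exists m.
apply/eqP; rewrite eqn_leq leC andbT; apply: leq_trans le; rewrite leq_add2r /=.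
have /in_orbitP <- := oC; rewrite leqNgt; apply/negP => lt.
have [[f [oA oB]] [f' [oA' oB']]] := (S12, S0).
have /negP := h0 (a, b); apply; apply/eqP; have [_ _ van] := qP (a, b).
apply: van => //=.
  by have [-> _] := in_orbit_dim oA; have [-> _] := in_orbit_dim oA'.
by have [_ ->] := in_orbit_dim oB; have [_ ->] := in_orbit_dim oB'.
Qed.

(** The polynomials that vanish on the rest of S(A, B) define a closed set. It
    does not meet the orbit of [C]: at a point of the orbit, a product of
    separators does not vanish, while any other point of S(A, B) has a larger
    intersection, where one of the factors vanishes. *)
Lemma tropical_open A B C : tropical (natmx A) (natmx B) (natmx C) ->
  is_open_orbit k A B C.
Proof.
move=> tC; have AB : composable (natmx A) (natmx B) by case: tC.
have [C' [tC' [f1 [f2 [S12 oC]]]]] := generic_orbit AB.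
have eC : C' = C by apply: natmx_inj; apply: tropical_inj tC' tC.
rewrite {}eC {C' tC'} in oC.
pose P q := multihomogeneous q /\
  forall h h', orbit_prod A B h h' -> ~~ in_orbit C h h' -> eval_flags q h h' = 0%R.
exists (fun h h' => forall q, P q -> eval_flags q h h' = 0%R).
  by exists P; split=> // q [].
have S_orbit h h' : in_orbit C h h' -> orbit_prod A B h h'.
  move=> oh; have [f [oA oB]] := S12.
  have [|G uG [<- <-]] := @same_relpos_act _ _ _ f1 f2 h h'.
    by rewrite (eqP oC) (eqP oh).
  by exists (flag_act G f); rewrite !in_orbit_act.
move=> h h'; split=> [oh|[Sh /existsNP[q /not_implyP[[hq van] q0]]]]; last first.
  by apply: contrapT => /negP oh; apply: q0; apply: van.
split; first exact: S_orbit.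
have /choice[q qP] (u : 'I_n.+1 * 'I_n.+1) := separator h h' u.1 u.2.
move=> Zh; have /eqP : eval_flags (\prod_u q u)%R h h' = 0%R.
  apply: Zh.
  split=> [|g g' Sg og]; first by apply: multihomogeneous_prod => u; case: (qP u).
  have [D oD] := in_orbit_relpos g g'.
  have [rD cD leD] := orbit_prod_le Sg oD.
  have [_ rC cC _ eqC] := tC.
  have [[dg dg'] [dh dh']] := (in_orbit_dim oD, in_orbit_dim oh).
  have [u ltu] : exists u : 'I_n.+1 * 'I_n.+1,
      \dim (h u.1 :&: h' u.2) < \dim (g u.1 :&: g' u.2).
    apply: contrapT => /forallNP le; case/negP: og; apply/in_orbitP => a b.
    have /in_orbitP capD := oD; have /in_orbitP caph := oh.
    have := le (a, b); rewrite /= capD caph => /negP; rewrite -leqNgt => leab.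
    apply/eqP; rewrite eqn_leq leab.
    by have [m em] := eqC a b; have := leD a m b; lia.
  have [_ _ van] := qP u.
  rewrite eval_flags_prod (bigD1 u) //= van ?mul0r //.
    by rewrite dg dh rD rC.
  by rewrite dg' dh' cD cC.
rewrite eval_flags_prod; apply/negP/prodf_neq0 => u _.
by case: (qP u).
Qed.

(** By irreducibility two non-empty open subsets of S(A, B) meet, and distinct
    orbits do not. *)
Lemma open_orbit_unique A B C C' :
  is_open_orbit k A B C -> is_open_orbit k A B C' -> C = C'.
Proof.
move=> [Z [P [hP ZP]] oZ] [Z' [P' [hP' ZP']] oZ'].
have pick D (Y : flag k n r -> flag k n r -> Prop) (Q : coord_poly k n r -> Prop) :
    (forall f f', Y f f' <-> forall q, Q q -> eval_flags q f f' = 0%R) ->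
    (forall f f', in_orbit D f f' <-> orbit_prod A B f f' /\ ~ Y f f') ->
  exists q f f', [/\ Q q, orbit_prod A B f f' & eval_flags q f f' != 0%R].
  move=> YQ oY; have [f [f' oD]] := orbit_nonempty k D.
  have [S12 nY] := (oY f f').1 oD.
  have /existsNP[q /not_implyP[Qq /eqP q0]] :
    ~ forall q, Q q -> eval_flags q f f' = 0%R by move/YQ.
  by exists q, f, f'.
have [q [f1 [f2 [Pq S12 q0]]]] := pick _ _ _ ZP oZ.
have [q' [f1' [f2' [Pq' S12' q0']]]] := pick _ _ _ ZP' oZ'.
have [h1 [h2 [Sh h0 h0']]] :=
  irreducible (hP _ Pq) (hP' _ Pq') S12 S12' q0 q0'.
apply: (@in_orbit_inj _ _ _ _ _ h1 h2).
  by apply/oZ; split=> // /ZP/(_ q Pq) /eqP; apply/negP.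
by apply/oZ'; split=> // /ZP'/(_ q' Pq') /eqP; apply/negP.
Qed.

Lemma open_orbit_tropical A B C : tropical (natmx A) (natmx B) (natmx C) ->
  open_orbit k A B = Some C.
Proof.
move=> /tropical_open oC; rewrite /open_orbit; case: pickP => [D /asboolP oD|].
  by rewrite (open_orbit_unique oD oC).
by move=> /(_ C) /asboolP.
Qed.

Lemma open_orbit_none A B : ~~ composable (natmx A) (natmx B) ->
  open_orbit k A B = None.
Proof.
move=> nAB; rewrite /open_orbit; case: pickP => // D /asboolP[Z _ oZ].
have [f [f' oD]] := orbit_nonempty k D.
by have [/orbit_prod_composable AB _] := (oZ f f').1 oD; rewrite AB in nAB.
Qed.

Lemma tropical_exists A B : composable (natmx A) (natmx B) ->
  exists C : posmx n r, tropical (natmx A) (natmx B) (natmx C).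
Proof. by move=> /generic_orbit[C [tC _]]; exists C. Qed.

End OpenOrbits.

(** * Counting lines and hyperplanes *)

Section CountSubspaces.
Variables (k : finFieldType) (r : nat).
Implicit Types (E F H L V W : {vspace 'rV[GRing.Field.sort k]_r}).

Definition lines F E := [set V | [&& (F <= V)%VS, (V <= E)%VS & \dim V == (\dim F).+1]].

Definition hyperplanes E F :=
  [set V | [&& (E <= V)%VS, (V <= F)%VS & \dim F == (\dim V).+1]].

Lemma card_setD_vspace F V : (F <= V)%VS ->
  #|[pred x | (x \in V) && (x \notin F)]| = #|k| ^ \dim V - #|k| ^ \dim F.
Proof.
move=> FV; rewrite -!card_vspace -(cardID (mem F) (mem V)).
rewrite [X in _ = X + _ - _](_ : _ = #|F|) ?addKn.
  by apply: eq_card => x; rewrite !inE andbC.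
apply: eq_card => x; rewrite !inE; apply: andb_idl; exact: subvP.
Qed.

(** Divided by [q ^ f], the hypothesis reads [q ^ d.+1 - 1 = N * (q - 1)]. *)
Lemma geometric_mod q f d N : 1 < q ->
  q ^ (f + d.+1) - q ^ f = N * (q ^ f.+1 - q ^ f) -> N = 1 %[mod q].
Proof.
move=> q_gt1; rewrite expnD -{2}[q ^ f]muln1 -mulnBr expnS mulnC.
rewrite expnS -[X in _ = _ * (_ - X)]mul1n -mulnBl mulnA => /eqP; rewrite eqn_pmul2r; last first.
  by rewrite expn_gt0 ltnW.
rewrite mulnBr muln1 => /eqP eN.
have : N + q * q ^ d = N * q + 1.
  have : 0 < q * q ^ d by rewrite muln_gt0 expn_gt0 ltnW.
  have : N <= N * q by rewrite leq_pmulr // ltnW.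
  by lia.
move=> /(congr1 (modn^~ q)) /=.
by rewrite addnC [q * _]mulnC !modnMDl.
Qed.

(** The vectors of [E] outside of [F] are sorted by the line of [E / F] that
    they span. *)
Lemma card_lines F E : (F <= E)%VS -> \dim F < \dim E ->
  #|lines F E| = 1 %[mod #|k|].
Proof.
move=> FE ltFE; have q_gt1 : 1 < #|k| := finNzRing_gt1 k.
have : #|[pred x | (x \in E) && (x \notin F)]|
    = #|lines F E| * (#|k| ^ (\dim F).+1 - #|k| ^ \dim F).
  rewrite -[LHS]sum1_card (partition_big (fun x : 'rV[GRing.Field.sort k]_r => (F + <[x]>)%VS) (fun V => V \in lines F E)) /=.
    rewrite -sum_nat_const; apply: eq_bigr => V; rewrite inE => /and3P[FV VE /eqP dV].
    rewrite -dV -card_setD_vspace // sum1_card; apply: eq_card => x.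
    rewrite !inE unfold_in /=.
    apply/andP/andP => [[/andP[_ xF] /eqP <-]|[xV xF]].
      by rewrite xF memvE addvSr.
    split; first by apply/andP; split; [exact: (subvP VE) | exact: xF].
    by rewrite eqEdim subv_add FV -memvE xV dim_add_line // dV leqnn.
  move=> x; rewrite !inE => /andP[xE xF].
  by rewrite addvSl subv_add FE -memvE xE dim_add_line // eqxx.
rewrite card_setD_vspace // -(subnKC ltFE) addSnnS.
exact: geometric_mod.
Qed.

(** Double counting of the pairs of a line in a hyperplane of [F / E]: modulo
    [q] there is one line in each hyperplane, and by induction one hyperplane
    around each line. *)
Lemma card_hyperplanes E F : (E <= F)%VS -> \dim E < \dim F ->
  #|hyperplanes E F| = 1 %[mod #|k|].
Proof.
have [m] := ubnP (\dim F - \dim E); elim: m E => // m IHm E ltm EF ltEF.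
have [dF|dF] := eqVneq (\dim F) (\dim E).+1.
  suff -> : hyperplanes E F = [set E] by rewrite cards1.
  apply/setP => V; rewrite !inE; apply/and3P/eqP => [[EV _ /eqP dV]|->].
    by apply/esym/eqP; rewrite eqEdim EV -ltnS -dV dF /=.
  by rewrite subvv dF.
have modsum (P : {set {vspace 'rV[GRing.Field.sort k]_r}}) N :
    (forall V, V \in P -> N V = 1 %[mod #|k|]) ->
    \sum_(V in P) N V = #|P| %[mod #|k|].
  move=> PN; rewrite -[#|P|]sum1_card -modn_summ -[RHS]modn_summ.
  by congr (_ %% _); apply: eq_bigr => V /PN.
rewrite -(modsum _ (fun H => #|lines E H|)); last first.
  move=> H; rewrite inE => /and3P[EH _ /eqP dH]; apply: card_lines => //.
  by move: dF ltEF; rewrite dH; lia.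
have -> : \sum_(H in hyperplanes E F) #|lines E H|
    = \sum_(L in lines E F) #|hyperplanes L F|.
  rewrite (eq_bigr (fun H => \sum_(L in lines E H) 1)); last first.
    by move=> H _; rewrite sum1_card.
  rewrite [RHS](eq_bigr (fun L => \sum_(H in hyperplanes L F) 1)); last first.
    by move=> L _; rewrite sum1_card.
  rewrite (exchange_big_dep (fun L => L \in lines E F)) /=.
    apply: eq_bigr => L; rewrite inE => /and3P[EL LF dL].
    apply: eq_bigl => H; rewrite !inE EL dL andbT /=.
    apply/andP/and3P => [[/and3P[_ HF dH] LH]|[LH HF dH]]; first by split.
    by rewrite LH HF dH (subv_trans EL LH).
  move=> H L; rewrite !inE => /and3P[_ HF _] /and3P[EL LH dL].
  by rewrite EL dL (subv_trans LH HF).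
rewrite modsum; first exact: card_lines.
move=> L; rewrite inE => /and3P[EL LF /eqP dL]; apply: IHm => //; lia.
Qed.

End CountSubspaces.

(** * Counting flags *)

(** The rank conditions for the orbit of [C] to be contained in the closure of
    S(A, B). *)
Definition below n (A B C : 'M[nat]_n) : bool :=
  [&& composable A B,
      [forall a : 'I_n.+1, rk C a n == rk A a n],
      [forall b : 'I_n.+1, rk C n b == rk B n b]
    & [forall a : 'I_n.+1, forall m : 'I_n.+1, forall b : 'I_n.+1,
        rk A a m + rk B m b <= rk C a b + rk A n m]].

Lemma belowP n (A B C : 'M[nat]_n) :
  reflect [/\ composable A B,
      forall a : 'I_n.+1, rk C a n = rk A a n,
      forall b : 'I_n.+1, rk C n b = rk B n b
    & forall a m b : 'I_n.+1, rk A a m + rk B m b <= rk C a b + rk A n m]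
    (below A B C).
Proof.
apply: (iffP and4P) => [[AB /forallP rC /forallP cC /forallP le]|[AB rC cC le]].
  split=> // [a|b|a m b]; [exact/eqP | exact/eqP |].
  by have /forallP/(_ m)/forallP := le a.
split=> //; first by apply/forallP => a; rewrite rC.
  by apply/forallP => b; rewrite cC.
by do 3!apply/forallP => ?.
Qed.

Section Flat.
Variables (k : fieldType) (n r : nat).
Implicit Types (f h : flag k n r).

Lemma dim_cap_chain f (a b : 'I_n.+1) :
  \dim (f a :&: f b) = minn (\dim (f a)) (\dim (f b)).
Proof.
have [ab|/ltnW ba] := leqP a b.
  by rewrite (capv_idPl (flag_mono f ab)) (minn_idPl _) // dimvS ?flag_mono.
by rewrite (capv_idPr (flag_mono f ba)) (minn_idPr _) // dimvS ?flag_mono.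
Qed.

(** The spaces of the two flags form a chain, so that each intersection is the
    smaller of the two spaces. *)
Lemma flat_orbit (G : posmx n r) f1 f (x : 'I_n.+1) :
    flat (natmx G) ->
    (forall a : 'I_n.+1, \dim (f1 a) = rk (natmx G) a n) ->
    (forall b : 'I_n.+1, \dim (f b) = rk (natmx G) n b) ->
    (forall m, m != x -> f m = f1 m) -> (f x <= f1 x)%VS || (f1 x <= f x)%VS ->
  in_orbit G f1 f.
Proof.
move=> Gf d1 d ff1 fx; apply/in_orbitP => a b; rewrite Gf -d1 -d.
have [->|bx] := eqVneq b x; last by rewrite ff1 // dim_cap_chain.
have [->|ax] := eqVneq a x; last by rewrite -ff1 // dim_cap_chain.
case/orP: fx => le; first by rewrite (capv_idPr le) (minn_idPr _) ?dimvS.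
by rewrite (capv_idPl le) (minn_idPl _) ?dimvS.
Qed.

Lemma flat_orbitE (G : posmx n r) f1 f (a : 'I_n.+1) :
    flat (natmx G) -> in_orbit G f1 f ->
  (rk (natmx G) a n <= rk (natmx G) n a -> (f1 a <= f a)%VS) /\
  (rk (natmx G) n a <= rk (natmx G) a n -> (f a <= f1 a)%VS).
Proof.
move=> Gf oG; have [d1 d] := in_orbit_dim oG; have /in_orbitP cap := oG.
split=> le; have := cap a a; rewrite Gf.
  rewrite (minn_idPl le) -d1 => eq; apply/capv_idPl/eqP.
  by rewrite eqEdim capvSl eq leqnn.
rewrite (minn_idPr le) -d => eq; apply/capv_idPr/eqP.
by rewrite eqEdim capvSr eq leqnn.
Qed.

Lemma flat_orbit_eq (G : posmx n r) f1 f (a : 'I_n.+1) :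
    flat (natmx G) -> in_orbit G f1 f ->
  rk (natmx G) a n = rk (natmx G) n a -> f a = f1 a.
Proof.
move=> Gf oG e; have [le1 le2] := flat_orbitE a Gf oG.
by apply/eqP; rewrite eqEsubv le1 ?le2 ?e.
Qed.

Lemma orbit_below (G B C : posmx n r) f1 f f2 :
    in_orbit C f1 f2 -> in_orbit G f1 f -> degen (relpos f f2) (natmx B) ->
  below (natmx G) (natmx B) (natmx C).
Proof.
move=> oC oG /degenP[rD cD leD].
have [D oD] := in_orbit_relpos f f2; rewrite (eqP oD) in rD cD leD.
have [dG1 dG] := in_orbit_dim oG; have [dC1 dC] := in_orbit_dim oC.
have [dD1 dD] := in_orbit_dim oD.
apply/belowP; split=> [|a|b|a m b].
- by apply/composableP => m; rewrite -dG -rD -dD1.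
- by rewrite -dC1 dG1.
- by rewrite -dC -cD dD.
move: oG oD oC (leD m b) => /in_orbitP <- /in_orbitP <- /in_orbitP <- le.
have := dim_cap_triangle f1 f f2 a m b; rewrite -dG; lia.
Qed.

End Flat.

Section CountFlags.
Variables (k : finFieldType) (n r : nat).
Implicit Types (f h : flag k n r) (G B C : posmx n r).

Definition closed_count G B f1 f2 : nat :=
  #|[pred f : flag k n r | in_orbit G f1 f && degen (relpos f f2) (natmx B)]|.

Lemma closed_count0 G B C f1 f2 : in_orbit C f1 f2 ->
  ~~ below (natmx G) (natmx B) (natmx C) -> closed_count G B f1 f2 = 0.
Proof.
move=> oC nb; apply: eq_card0 => f; rewrite !inE; apply/negP => /andP[oG dB].
by rewrite (orbit_below oC oG dB) in nb.
Qed.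

Lemma is_flag_subst f (i j : 'I_n) V : j = i.+1 :> nat ->
    (f (lo i) <= V)%VS -> (V <= f (hi j))%VS ->
  is_flag [ffun m => if m == hi i then V else f m].
Proof.
move=> ji fV Vf; apply/and3P; split; rewrite ?ffunE.
- by rewrite flag0.
- by rewrite eq_hi /= -ji gtn_eqF ?ltn_ord // flag_max.
apply/forallP => l; rewrite !ffunE !eq_hi hiE eqSS /=.
case: eqP => [li|_]; case: eqP => [lj|_]; rewrite ?subvv ?flag_step //.
  rewrite (_ : hi l = hi j) //; apply: val_inj.
  by rewrite [LHS]hiE [RHS]hiE li -ji.
by rewrite (_ : lo l = lo i) //; apply: val_inj.
Qed.

Definition flag_subst f (x : 'I_n.+1) V : flag k n r :=
  insubd f [ffun m => if m == x then V else f m].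

Lemma flag_substE f (i j : 'I_n) V m : j = i.+1 :> nat ->
    (f (lo i) <= V)%VS -> (V <= f (hi j))%VS ->
  flag_subst f (hi i) V m = if m == hi i then V else f m.
Proof.
move=> ji fV Vf; rewrite /flag_subst /insubd insubT ?(is_flag_subst ji fV Vf) //.
by move=> ?; rewrite ffunE.
Qed.

Section Count.
Variables (G B C : posmx n r) (f1 f2 : flag k n r) (i j : 'I_n).
Hypotheses (ji : j = i.+1 :> nat) (oC : in_orbit C f1 f2).
Hypothesis GBC : below (natmx G) (natmx B) (natmx C).
Local Notation x := (hi i).

(** Away from [x] the flag is [f1], and there the conditions for the closure
    of e_B hold already: they are the inequalities of [below] at [m = a]. *)
Lemma count_setup : flat (natmx G) ->
    (forall m, m != x -> rk (natmx G) m n = rk (natmx G) n m) ->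
  forall f, reflect
    [/\ forall m, m != x -> f m = f1 m, \dim (f x) = rk (natmx G) n x,
        (f x <= f1 x)%VS || (f1 x <= f x)%VS
      & forall b : 'I_n.+1, rk (natmx B) x b <= \dim (f x :&: f2 b)]
    (in_orbit G f1 f && degen (relpos f f2) (natmx B)).
Proof.
move=> Gf Gm f; have /belowP[/composableP GB rC cC le] := GBC.
have [dC1 dC] := in_orbit_dim oC.
apply: (iffP andP) => [[oG /degenP[rD cD leD]]|[ff1 dfx fx leB]].
  have [dG1 dG] := in_orbit_dim oG.
  split=> [m /Gm|||b]; [exact: flat_orbit_eq | exact: dG | | ].
    have [le1 le2] := flat_orbitE x Gf oG.
    have [/le1->|/ltnW/le2->] := leqP (rk (natmx G) x n) (rk (natmx G) n x);
      by rewrite ?orbT.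
  by rewrite dim_cap leD.
have d1 (a : 'I_n.+1) : \dim (f1 a) = rk (natmx G) a n by rewrite dC1 rC.
have d (a : 'I_n.+1) : \dim (f a) = rk (natmx G) n a.
  by have [->//|ax] := eqVneq a x; rewrite ff1 // d1 Gm.
split; first exact: flat_orbit ff1 fx.
apply/degenP; split=> [a|b|a b].
- by rewrite -[n in rk _ a n]/(nat_of_ord (@ord_max n)) -dim_cap flag_max capvf d GB.
- by rewrite -[n in rk _ n b]/(nat_of_ord (@ord_max n)) -dim_cap flag_max capfv dC cC.
rewrite -dim_cap; have [->//|ax] := eqVneq a x; rewrite ff1 //.
have /in_orbitP -> := oC; have := le a a b.
by rewrite Gf Gm // minnn; lia.
Qed.

Lemma closed_count_subst (S : {set {vspace 'rV[GRing.Field.sort k]_r}}) :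
    flat (natmx G) ->
    (forall m, m != x -> rk (natmx G) m n = rk (natmx G) n m) ->
    (forall f, in_orbit G f1 f && degen (relpos f f2) (natmx B) -> f x \in S) ->
    (forall V, V \in S -> [/\ (f1 (lo i) <= V)%VS, (V <= f1 (hi j))%VS,
      \dim V = rk (natmx G) n x, (V <= f1 x)%VS || (f1 x <= V)%VS
      & forall b : 'I_n.+1, rk (natmx B) x b <= \dim (V :&: f2 b)]) ->
  closed_count G B f1 f2 = #|S|.
Proof.
move=> Gf Gm toS ofS.
rewrite -(card_in_imset (f := fun V => flag_subst f1 x V) (D := S)).
  apply: eq_card => f; rewrite inE; apply/idP/imsetP => [fX|[V VS ->]].
    exists (f x); first exact: toS.
    have [loV Vhi _ _ _] := ofS _ (toS _ fX).
    have /(count_setup Gf Gm)[ff1 _ _ _] := fX.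
    apply: flag_ext => m; rewrite (flag_substE _ ji) //.
    by case: eqVneq => [->|/ff1].
  have [loV Vhi dV cmpV leV] := ofS _ VS.
  have E m := flag_substE m ji loV Vhi.
  by apply/(count_setup Gf Gm); split=> [m mx|||b]; rewrite E ?(negPf mx) ?eqxx.
move=> V V' VS VS' /(congr1 (fun f : flag k n r => f x)).
have [loV Vhi _ _ _] := ofS _ VS; have [loV' Vhi' _ _ _] := ofS _ VS'.
by rewrite !(flag_substE _ ji) // eqxx.
Qed.

Lemma dim_sum_cap (a a' b : 'I_n.+1) : a <= a' ->
  \dim (f1 a + (f1 a' :&: f2 b)) + rk (natmx C) a b
  = \dim (f1 a) + rk (natmx C) a' b.
Proof.
move=> aa'; have /in_orbitP cap := oC; rewrite -!cap -[RHS]dimv_sum_cap.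
by rewrite capvA (capv_idPl (flag_mono f1 aa')).
Qed.

Lemma lo_neq : lo i != x.
Proof. by rewrite eq_hi /= ltn_eqF. Qed.

Lemma hi_neq : hi j != x.
Proof. by rewrite eq_hi hiE ji gtn_eqF. Qed.

(** The space to be chosen is a hyperplane of [f1 x] that contains [f1 (lo
    i)]. It meets [f2 b] in at least [rk B x b] dimensions, unless [rk B x b]
    is the dimension of [f1 x :&: f2 b] and the hyperplane does not contain
    this space. These spaces increase with [b], so the largest such [b] gives
    the only condition. *)
Lemma closed_count_up : up_step (natmx G) x ->
  closed_count G B f1 f2 = 1 %[mod #|k|].
Proof.
move=> [Gf Gr]; have Gm m : m != x -> rk (natmx G) m n = rk (natmx G) n m.
  by move=> /negPf mx; rewrite Gr mx addn0.
have /belowP[/composableP GB rC cC le] := GBC.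
have [dC1 dC] := in_orbit_dim oC; have /in_orbitP cap := oC.
have d1 (a : 'I_n.+1) : \dim (f1 a) = rk (natmx G) a n by rewrite dC1 rC.
have rx : rk (natmx G) x n = (rk (natmx G) n x).+1 by rewrite Gr eqxx addn1.
(* The places where no dimension may be lost; 0 is one of them. *)
pose tight (b : 'I_n.+1) := rk (natmx C) x b == rk (natmx B) x b.
have tight0 : tight ord0 by rewrite /tight !rk0r.
have [b0 /eqP tb0 maxb0] : exists2 b0 : 'I_n.+1, tight b0 &
    forall b : 'I_n.+1, tight b -> b <= b0.
  by case: (@arg_maxnP _ ord0 tight (fun b => b : nat) tight0) => b0; exists b0.
pose E := (f1 (lo i) + (f1 x :&: f2 b0))%VS.
have lox : lo i <= x by rewrite hiE /=.
have Ex : (E <= f1 x)%VS by rewrite subv_add flag_step capvSl.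
rewrite (closed_count_subst (S := hyperplanes E (f1 x)) Gf Gm).
- apply: card_hyperplanes => //.
  have := dim_sum_cap b0 lox; rewrite -/E; have := le (lo i) (lo i) b0.
  rewrite Gf !d1 (Gm (lo i)) ?lo_neq // minnn tb0 rx !GB.
  have := rk_super (natmx B) lox (ltn_ord b0 : b0 <= n); lia.
- move=> f /(count_setup Gf Gm)[ff1 dfx fx leB]; rewrite inE.
  have fx1 : (f x <= f1 x)%VS.
    case/orP: fx => // fx; have := dimvS fx; rewrite dfx d1; lia.
  rewrite fx1 d1 dfx rx eqxx andbT /= subv_add -{1}(ff1 (lo i)) ?lo_neq //.
  rewrite flag_step /= (_ : f1 x :&: f2 b0 = f x :&: f2 b0)%VS ?capvSl //.
  apply/esym/eqP; rewrite eqEdim capvS //= cap tb0.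
  exact: leB.
move=> V; rewrite inE => /and3P[EV Vx /eqP dV]; split.
- by apply: subv_trans EV; apply: addvSl.
- apply: subv_trans Vx _; apply: flag_mono; rewrite !hiE ji; lia.
- by move: dV; rewrite d1 rx; lia.
- by rewrite Vx.
move=> b; have [/eqP tb|tb] := boolP (tight b).
  rewrite -tb -cap dimvS // subv_cap capvSr andbT.
  apply: subv_trans EV; apply: subv_trans (addvSr _ _).
  by apply: capvS => //; apply/flag_mono/maxb0/eqP.
have := dimv_sum_cap V (f1 x :&: f2 b)%VS; rewrite capvA (capv_idPl Vx) cap.
have : \dim (V + (f1 x :&: f2 b)) <= \dim (f1 x).
  by apply: dimvS; rewrite subv_add Vx capvSl.
have := le x x b; rewrite Gf rx (minn_idPr _) //.
move: tb; rewrite /tight; lia.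
Qed.

(** The space to be chosen is a line over [f1 x] in [f1 (hi j)]. Where [f1 x
    :&: f2 b] is too small by one dimension, the line has to come from [f1 (hi
    j) :&: f2 b]; the smallest such [b] gives the only condition. *)
Lemma closed_count_down : down_step (natmx G) x ->
  closed_count G B f1 f2 = 1 %[mod #|k|].
Proof.
move=> [Gf Gr]; have Gm m : m != x -> rk (natmx G) m n = rk (natmx G) n m.
  by move=> /negPf mx; rewrite Gr mx addn0.
have /belowP[/composableP GB rC cC le] := GBC.
have [dC1 dC] := in_orbit_dim oC; have /in_orbitP cap := oC.
have d1 (a : 'I_n.+1) : \dim (f1 a) = rk (natmx G) a n by rewrite dC1 rC.
have rx : rk (natmx G) n x = (rk (natmx G) x n).+1 by rewrite Gr eqxx addn1.
(* The places where a dimension has to be gained. At [ord_max], added so that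
   there is a first place, the condition is void. *)
pose short (b : 'I_n.+1) := (rk (natmx C) x b < rk (natmx B) x b) || (b == ord_max).
have shortm : short ord_max by rewrite /short eqxx orbT.
have [b0 sb0 minb0] : exists2 b0 : 'I_n.+1, short b0 &
    forall b : 'I_n.+1, short b -> b0 <= b.
  by case: (@arg_minnP _ ord_max short (fun b => b : nat) shortm) => b0; exists b0.
pose E := (f1 x + (f1 (hi j) :&: f2 b0))%VS.
have xhi : x <= hi j by rewrite !hiE ji.
have xE : (f1 x <= E)%VS by apply: addvSl.
have leG : rk (natmx G) n x <= rk (natmx G) (hi j) n.
  by rewrite Gm ?hi_neq // rk_mono.
rewrite (closed_count_subst (S := lines (f1 x) E) Gf Gm).
- apply: card_lines => //.
  case/orP: sb0 => [sb0|/eqP eb0]; last first.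
    rewrite /E eb0 flag_max capvf (addv_idPr (flag_mono f1 xhi)) !d1; lia.
  have := dim_sum_cap b0 xhi; rewrite -/E; have := le (hi j) (hi j) b0.
  rewrite Gf Gm ?hi_neq // minnn d1.
  have := rk_mono (natmx B) xhi (leqnn b0); lia.
- move=> f /(count_setup Gf Gm)[ff1 dfx fx leB]; rewrite inE.
  have fx1 : (f1 x <= f x)%VS.
    case/orP: fx => // fx; have := dimvS fx; rewrite dfx d1; lia.
  rewrite fx1 d1 dfx rx eqxx andbT /=.
  have fxhi : (f x <= f1 (hi j))%VS by rewrite -ff1 ?hi_neq ?flag_mono.
  case/orP: sb0 => [sb0|/eqP eb0]; last first.
    by rewrite /E eb0 flag_max capvf (subv_trans fxhi) ?addvSr.
  have -> : f x = (f1 x + (f x :&: f2 b0))%VS.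
    apply/esym/eqP; rewrite eqEdim subv_add fx1 capvSl !andTb dfx rx -d1.
    have := dimv_sum_cap (f1 x) (f x :&: f2 b0)%VS.
    rewrite capvA (capv_idPl fx1) cap; have := leB b0; lia.
  by rewrite addvS // capvS.
move=> V; rewrite inE => /and3P[xV VE /eqP dV].
have Vhi : (V <= f1 (hi j))%VS.
  by apply: subv_trans VE _; rewrite subv_add (flag_mono f1 xhi) capvSl.
split=> //.
- by apply: subv_trans xV; apply: flag_step.
- by rewrite dV d1 rx.
- by rewrite xV orbT.
move=> b; have [sb|nsb] := boolP (rk (natmx C) x b < rk (natmx B) x b); last first.
  by move: nsb; rewrite -leqNgt => /leq_trans; apply; rewrite -cap dimvS ?capvS.
have b0b : b0 <= b by apply: minb0; rewrite /short sb.
have eV : (V = f1 x + (V :&: f2 b))%VS.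
  rewrite (capvC V) vspace_modl //; apply/esym/capv_idPr.
  apply: subv_trans VE _; apply: addvS => //; apply: subv_trans (capvSr _ _) _.
  exact: flag_mono.
have := dimv_sum_cap (f1 x) (V :&: f2 b)%VS.
rewrite -eV capvA (capv_idPl xV) cap dV d1.
have := le x x b; rewrite Gf rx (minn_idPl _) //; lia.
Qed.

End Count.

Lemma closed_count_diag G B C f1 f2 : 0 < n -> in_orbit C f1 f2 ->
    below (natmx G) (natmx B) (natmx C) ->
    flat (natmx G) -> (forall m : 'I_n.+1, rk (natmx G) m n = rk (natmx G) n m) ->
  closed_count G B f1 f2 = 1.
Proof.
move=> n_gt0 oC GBC Gf Gm; rewrite -(card1 f1); apply: eq_card => f.
have /belowP[/composableP GB rC cC le] := GBC; have [dC1 dC] := in_orbit_dim oC.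
rewrite inE [RHS]inE; apply/idP/eqP => [/andP[oG _]|->].
  by apply: flag_ext => m; apply: flat_orbit_eq Gf oG (Gm m).
have /in_orbitP cap := oC.
apply/andP; split.
  by apply: (flat_orbit (x := ord0)) => // [a|a|]; rewrite ?subvv // dC1 rC ?Gm.
apply/degenP; rewrite (eqP oC); split=> [a|b|a b].
- by rewrite rC Gm GB.
- exact: cC.
by have := le a a b; rewrite Gf Gm minnn; lia.
Qed.

End CountFlags.

(** * Free modules with structure constants *)

Section ValueAtZero.
Local Open Scope ring_scope.

Lemma dvdz_horner0 (P : {poly int}) (x : int) : (x %| P.[x] - P.[0])%Z.
Proof.
apply/dvdzP; exists (drop_poly 1 P).[x].
rewrite -{1 2}[P](poly_take_drop 1) expr1 !hornerD !hornerM !hornerX mulr0 addr0.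
have -> : take_poly 1 P = (P`_0)%:P.
  by apply/polyP => -[|m]; rewrite coef_take_poly coefC.
by rewrite !hornerC addrC addKr.
Qed.

(** [P.[p]] and [P.[0]] agree modulo [p], and an integer divisible by all
    primes is zero. *)
Lemma horner0_primes (P : {poly int}) (c : int) :
  (forall p : nat, prime p -> (p %| P.[p%:R] - c)%Z) -> P.[0] = c.
Proof.
move=> Pc; apply/eqP; rewrite -subr_eq0 -absz_eq0.
have [p ltp pp] := prime_above `|P.[0] - c|%N.
have : (p %| P.[0] - c)%Z.
  have -> : P.[0] - c = (P.[p%:R] - c) - (P.[p%:R] - P.[0]).
    by lia.
  by rewrite rpredB ?Pc //; have := dvdz_horner0 P p; rewrite natz.
rewrite dvdzE => /dvdnP[[->//|m] e]; move: ltp; rewrite e /=; lia.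
Qed.

End ValueAtZero.

Section FreeModules.
Variables (n r : nat).
Local Open Scope ring_scope.
Local Notation fmod := (free_mod n r int).
Implicit Types (x y z : fmod) (A B C : posmx n r).

Definition orb A : fmod := [ffun C => (C == A)%:R].

Lemma basis_eltE A : basis_elt r (natmx A) = orb A.
Proof. by apply/ffunP => C; rewrite !ffunE (inj_eq (@natmx_inj _ _)). Qed.

Lemma orb_expand x : x = \sum_A orb A *~ x A.
Proof.
apply/ffunP => C; rewrite sum_ffunE (bigD1 C) //= big1 ?addr0.
  by rewrite ffunMzE ffunE eqxx mulrzz mul1r.
by move=> A nAC; rewrite ffunMzE ffunE eq_sym (negPf nAC) mul0rz.
Qed.

Lemma additive_ext (phi psi : fmod -> fmod) :
    {morph phi : x y / x + y} -> {morph psi : x y / x + y} ->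
  (forall A, phi (orb A) = psi (orb A)) -> phi =1 psi.
Proof.
have expand (f : fmod -> fmod) : {morph f : x y / x + y} ->
    forall x, f x = \sum_A f (orb A) *~ x A.
  move=> fD; have f0 : f 0 = 0 by apply: (addrI (f 0)); rewrite -fD !addr0.
  have fN x : f (- x) = - f x.
    by apply: (addrI (f x)); rewrite -fD !addrN f0.
  have fMn x m : f (x *+ m) = f x *+ m.
    by elim: m => [|m IHm]; rewrite ?mulr0n ?f0 // !mulrS fD IHm.
  move=> x; rewrite {1}[x]orb_expand (big_morph f fD f0); apply: eq_bigr => A _.
  by case: (x A) => m; rewrite ?NegzE ?mulrNz ?fN -?pmulrn fMn.
by move=> phiD psiD eq x; rewrite !expand //; apply: eq_bigr => A _; rewrite eq.
Qed.

Section Bilinear.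
Variable c : struct_consts n r int.
Local Notation "x ** y" := (bilin_mul c x y) (at level 40).

Lemma bilin_mulDl x y z : (x + y) ** z = x ** z + y ** z.
Proof.
apply/ffunP => C; rewrite !ffunE -big_split; apply: eq_bigr => A _ /=.
by rewrite -big_split; apply: eq_bigr => B _; rewrite ffunE /= !mulrDl.
Qed.

Lemma bilin_mulDr x y z : x ** (y + z) = x ** y + x ** z.
Proof.
apply/ffunP => C; rewrite !ffunE -big_split; apply: eq_bigr => A _ /=.
by rewrite -big_split; apply: eq_bigr => B _; rewrite ffunE /= mulrDr mulrDl.
Qed.

Lemma bilin_mul0r x : x ** 0 = 0.
Proof. by apply: (addrI (x ** 0)); rewrite -bilin_mulDr !addr0. Qed.

Lemma bilin_mul_orbl A y : orb A ** y = [ffun C => \sum_B y B * c A B C].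
Proof.
apply/ffunP => C; rewrite !ffunE (bigD1 A) //= [X in _ + X]big1 ?addr0.
  by apply: eq_bigr => B _; rewrite ffunE eqxx mul1r.
move=> A' A'A; rewrite big1 // => B _; rewrite ffunE (negPf A'A).
by rewrite !mul0r.
Qed.

Lemma bilin_mul_orb A B : orb A ** orb B = [ffun C => c A B C].
Proof.
rewrite bilin_mul_orbl; apply/ffunP => C; rewrite !ffunE (bigD1 B) //= big1.
  by rewrite addr0 ffunE eqxx mul1r.
by move=> B' B'B; rewrite ffunE (negPf B'B) mul0r.
Qed.

Lemma bilin_mul_orbr x B : x ** orb B = [ffun C => \sum_A x A * c A B C].
Proof.
apply/ffunP => C; rewrite !ffunE; apply: eq_bigr => A _.
rewrite (bigD1 B) //= big1 ?addr0; first by rewrite ffunE eqxx mulr1.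
by move=> B' B'B; rewrite ffunE (negPf B'B) mulr0 mul0r.
Qed.

Lemma bilin_mulA :
    (forall A B D C, \sum_E c A B E * c E D C = \sum_E c B D E * c A E C) ->
  forall x y z, (x ** y) ** z = x ** (y ** z).
Proof.
move=> cA x y z; move: x; apply: additive_ext => [x x'|x x'|A].
- by rewrite !bilin_mulDl.
- by rewrite bilin_mulDl.
move: y; apply: (@additive_ext (fun y => (orb A ** y) ** z)) => [y y'|y y'|B].
- by rewrite bilin_mulDr bilin_mulDl.
- by rewrite bilin_mulDl bilin_mulDr.
move: z; apply: (@additive_ext (fun z => (orb A ** orb B) ** z)) => [z z'|z z'|D].
- by rewrite bilin_mulDr.
- by rewrite !bilin_mulDr.
rewrite !bilin_mul_orb bilin_mul_orbl bilin_mul_orbr; apply/ffunP => C.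
rewrite !ffunE; under eq_bigr do rewrite ffunE.
by under [RHS]eq_bigr do rewrite ffunE.
Qed.

End Bilinear.
End FreeModules.

(** * Structure constants at zero *)

Section SchurAtZero.
Variables (n r : nat) (g : struct_consts n r {poly int}).
Hypothesis gP : is_schur_polynomials g.
Local Open Scope ring_scope.
Implicit Types (A B C D E G : posmx n r).
Local Notation flagp p := (flag 'F_p n r).

Lemma schur_count (p : nat) A B C (f1 f2 : flagp p) : prime p ->
  in_orbit C f1 f2 ->
  (g A B C).[p%:R]
  = (\sum_(f : flagp p | in_orbit A f1 f && in_orbit B f f2) 1)%N%:R.
Proof.
move=> pp oC; have := gP A B oC; rewrite card_Fp // => ->.
by rewrite sum1_card.
Qed.

(** At a prime [p] both sides count the pairs of flags over the field with [p]
    elements in given relative positions. *)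
Lemma schur0_assoc A B D C :
  \sum_E (g A B E).[0] * (g E D C).[0] = \sum_E (g B D E).[0] * (g A E C).[0].
Proof.
pose L := \sum_E g A B E * g E D C; pose R := \sum_E g B D E * g A E C.
suff : (L - R).[0] = 0.
  rewrite hornerD hornerN => /eqP; rewrite subr_eq0 /L /R !horner_sum => /eqP.
  by under eq_bigr do rewrite hornerM; under [RHS]eq_bigr do rewrite hornerM.
apply: horner0_primes => p pp; rewrite subr0 hornerD hornerN.
suff -> : L.[p%:R] = R.[p%:R] by rewrite subrr dvdz0.
have [f1 [f2 oC]] := orbit_nonempty 'F_p C.
pose N := (\sum_(f : flagp p) \sum_(f' : flagp p)
  [&& in_orbit A f1 f, in_orbit B f f' & in_orbit D f' f2])%N.
have unfold_orbit (h h' : flagp p) (F : posmx n r -> nat) E0 :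
    in_orbit E0 h h' -> (\sum_(E | in_orbit E h h') F E = F E0)%N.
  move=> o0; rewrite (big_pred1 E0) // => E /=.
  by apply/idP/eqP => [oE|->//]; apply: in_orbit_inj oE o0.
transitivity (N%:R : int).
  rewrite /L horner_sum.
  rewrite (eq_bigr (fun E => (\sum_(f' : flagp p | in_orbit E f1 f' && in_orbit D f' f2)
    \sum_(f : flagp p | in_orbit A f1 f && in_orbit B f f') 1)%N%:R)); last first.
    move=> E _; rewrite hornerM (schur_count E D pp oC) natr_sum mulr_sumr natr_sum.
    by apply: eq_bigr => f' /andP[oE _]; rewrite mulr1 (schur_count A B pp oE).
  rewrite -natr_sum; congr (_%:R).
  rewrite (exchange_big_dep (fun f' => in_orbit D f' f2)) /=; last first.
    by move=> E f' _ /andP[].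
  rewrite /N exchange_big /= big_mkcond; apply: eq_bigr => f' _.
  case: ifP => oD; last by rewrite big1 // => f _; rewrite !andbF.
  have [E0 o0] := in_orbit_relpos f1 f'.
  rewrite (eq_bigl (fun E => in_orbit E f1 f')); last by move=> E; rewrite oD andbT.
  rewrite (unfold_orbit _ _ (fun=> _) _ o0) big_mkcond; apply: eq_bigr => f _.
  by rewrite andbT; case: (_ && _).
symmetry; rewrite /R horner_sum.
rewrite (eq_bigr (fun E => (\sum_(f : flagp p | in_orbit A f1 f && in_orbit E f f2)
  \sum_(f' : flagp p | in_orbit B f f' && in_orbit D f' f2) 1)%N%:R)); last first.
  move=> E _; rewrite hornerM (schur_count A E pp oC) natr_sum mulr_sumr natr_sum.
  by apply: eq_bigr => f /andP[_ oE]; rewrite mulr1 (schur_count B D pp oE).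
rewrite -natr_sum; congr (_%:R).
rewrite (exchange_big_dep (fun f => in_orbit A f1 f)) /=; last first.
  by move=> E f _ /andP[].
rewrite /N [LHS]big_mkcond; apply: eq_bigr => f _.
case: ifP => oA; last by rewrite big1.
have [E0 o0] := in_orbit_relpos f f2.
rewrite (eq_bigl (fun E => in_orbit E f f2)); last by move=> E; rewrite oA.
rewrite (unfold_orbit _ _ (fun=> _) _ o0) big_mkcond; apply: eq_bigr => f' _.
by case: (_ && _).
Qed.

Lemma schur_closed_count (p : nat) G B C (f1 f2 : flagp p) : prime p ->
    in_orbit C f1 f2 ->
  \sum_(B' | degen (natmx B') (natmx B)) (g G B' C).[p%:R]
  = (closed_count G B f1 f2)%:R.
Proof.
move=> pp oC; under eq_bigr do rewrite (schur_count _ _ pp oC).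
rewrite -natr_sum; congr (_%:R); rewrite (exchange_big_dep (in_orbit G f1)) /=.
  rewrite /closed_count -sum1_card big_mkcond [RHS]big_mkcond.
  apply: eq_bigr => f _; rewrite inE; case: ifP => //= oG.
  have [E oE] := in_orbit_relpos f f2; rewrite (eqP oE).
  rewrite (eq_bigl (fun B' => (B' == E) && degen (natmx E) (natmx B))).
    by rewrite big_mkcondr big_pred1_eq.
  move=> B' /=; rewrite oG; case: eqP => [->|ne]; first by rewrite oE andbC.
  by apply/negP => /andP[_ oB']; apply/ne/(in_orbit_inj oB' oE).
by move=> B' f _ /andP[].
Qed.

Inductive generator (M : 'M[nat]_n) : Prop :=
| GenK d of M = diag_nat d
| GenE (i j : 'I_n) d of j = i.+1 :> nat & (0 < d j)%N & M = move_nat d i j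
| GenF (i j : 'I_n) d of j = i.+1 :> nat & (0 < d i)%N & M = move_nat d j i.

Lemma generator_flat (M : 'M[nat]_n) : generator M -> flat M.
Proof.
case=> [d ->|i j d ji dj ->|i j d ji di ->].
- by case: (flat_k d).
- by case: (up_step_e ji dj) => -[].
- by case: (down_step_f ji di) => -[].
Qed.

Lemma closed_count_generator (k : finFieldType) G B C (f1 f2 : flag k n r) :
    (0 < n)%N -> generator (natmx G) -> in_orbit C f1 f2 ->
  closed_count G B f1 f2 = below (natmx G) (natmx B) (natmx C) %[mod #|k|].
Proof.
move=> n_gt0 genG oC; have [GBC|nGBC] := boolP (below _ _ _); last first.
  by rewrite (closed_count0 oC nGBC).
case: genG => [d eG|i j d ji dj eG|i j d ji di eG].
- by rewrite (closed_count_diag n_gt0 oC GBC) // eG; have [] := flat_k d.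
- by apply: (closed_count_up ji oC GBC); rewrite eG; have [] := up_step_e ji dj.
- by apply: (closed_count_down ji oC GBC); rewrite eG; have [] := down_step_f ji di.
Qed.

Lemma schur0_generator G B C : (0 < n)%N -> generator (natmx G) ->
  \sum_(B' | degen (natmx B') (natmx B)) (g G B' C).[0]
  = (below (natmx G) (natmx B) (natmx C))%:R.
Proof.
move=> n_gt0 genG; rewrite -horner_sum; apply: horner0_primes => p pp.
have [f1 [f2 oC]] := orbit_nonempty 'F_p C.
rewrite horner_sum (schur_closed_count G B pp oC).
have := closed_count_generator B n_gt0 genG oC; rewrite card_Fp // => /eqP.
by rewrite -eqz_mod_dvd !natz -eqz_nat -!modz_nat => /eqP ->.
Qed.

End SchurAtZero.

(** * The isomorphism *)

Section ClosureMap.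
Variables (n r : nat).
Local Open Scope ring_scope.
Local Notation fmod := (free_mod n r int).
Implicit Types (x y : fmod) (A B C G : posmx n r).

Definition closure_map x : fmod :=
  [ffun C => \sum_(A | degen (natmx C) (natmx A)) x A].

Lemma closure_mapD : {morph closure_map : x y / x + y}.
Proof.
move=> x y; apply/ffunP => C; rewrite !ffunE -big_split.
by apply: eq_bigr => A _; rewrite ffunE.
Qed.

Lemma closure_map0 : closure_map 0 = 0.
Proof. by apply: (addrI (closure_map 0)); rewrite -closure_mapD !addr0. Qed.

Lemma closure_map_orb A :
  closure_map (orb A) = [ffun C => (degen (natmx C) (natmx A))%:R].
Proof.
apply/ffunP => C; rewrite !ffunE; under eq_bigr do rewrite ffunE.
have [CA|nCA] := boolP (degen _ _).
  rewrite (bigD1 A) //= eqxx big1 ?addr0 // => B /andP[_ /negPf BA].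
  by rewrite BA.
by rewrite big1 // => B CB; case: eqP => // BA; rewrite -BA CB in nCA.
Qed.

Lemma rk_le_flat (M : 'M[nat]_n) (a b : 'I_n.+1) :
  (rk M a b <= minn (rk M a n) (rk M n b))%N.
Proof. by rewrite leq_min !rk_mono // -ltnS. Qed.

(** A flat orbit is closed, since no intersection is larger than the smaller
    of the two spaces. *)
Lemma closure_map_flat G : flat (natmx G) -> closure_map (orb G) = orb G.
Proof.
move=> Gf; rewrite closure_map_orb; apply/ffunP => C; rewrite !ffunE.
congr (_ %:R); congr nat_of_bool; apply/idP/eqP => [CG|->]; last exact: degen_refl.
apply/natmx_inj/(degen_anti CG); have /degenP[rC cC _] := CG.
by apply/degenP; split=> // a b; rewrite Gf -rC -cC rk_le_flat.
Qed.

Lemma basis_elt_cases (M : 'M[nat]_n) :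
  (exists2 A : posmx n r, natmx A = M & basis_elt r M = orb A)
  \/ basis_elt r M = 0.
Proof.
have [[A eA]|nA] := pselect (exists A : posmx n r, natmx A = M).
  by left; exists A; rewrite -?eA ?basis_eltE.
right; apply/ffunP => C; rewrite !ffunE; case: eqP => // eC.
by case: nA; exists C.
Qed.

Lemma closure_map_basis (M : 'M[nat]_n) :
  flat M -> closure_map (basis_elt r M) = basis_elt r M.
Proof.
move=> Mf; case: (basis_elt_cases M) => [[A eA ->]|->].
  by apply: closure_map_flat; rewrite eA.
by apply/ffunP => C; rewrite !ffunE big1 // => A _; rewrite ffunE.
Qed.

Definition depth C := (\sum_(a : 'I_n.+1) \sum_(b : 'I_n.+1) rk (natmx C) a b)%N.

Lemma degen_depth C A : degen (natmx C) (natmx A) -> C != A -> (depth A < depth C)%N.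
Proof.
move=> CA neq; have /degenP[_ _ le] := CA.
rewrite ltn_neqAle leq_sum ?andbT; last by move=> a _; apply: leq_sum.
apply: contraNneq neq => eq; apply/eqP/natmx_inj/rk_inj => a b.
have /eqP := eq; rewrite eq_sym; set s := (X in X == _) => es.
have := leqif_sum (fun (a : 'I_n.+1) (_ : true) => leqif_sum
  (fun (b : 'I_n.+1) (_ : true) => leqif_eq (le a b))).
case=> _; rewrite -/(depth A) -/(depth C) eq eqxx => /esym/forallP/(_ a)/forallP/(_ b).
by move/eqP.
Qed.

(** The matrix of the closure map is unitriangular for the order by closure,
    along which [depth] is strictly monotone. *)
Lemma closure_map_bij : bijective closure_map.
Proof.
have mapN x : closure_map (- x) = - closure_map x.
  by apply/ffunP => C; rewrite !ffunE -sumrN; apply: eq_bigr => A _; rewrite ffunE.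
have inj : injective closure_map.
  move=> x y exy; apply/eqP; rewrite -subr_eq0; apply/eqP; set z := x - y.
  have z0 : closure_map z = 0 by rewrite closure_mapD mapN exy subrr.
  suff zC C : z C = 0 by apply/ffunP => C; rewrite zC ffunE.
  (* All other orbits with [C] in their closure are less deep. *)
  have [m] := ubnP (depth C); elim: m C => // m IHm C ltm.
  have /ffunP/(_ C) := z0; rewrite [LHS]ffunE [RHS]ffunE (bigD1 C) ?degen_refl //= big1 ?addr0 //.
  move=> A /andP[CA AnC]; apply: IHm; rewrite -ltnS.
  by apply: leq_trans ltm; rewrite ltnS degen_depth // eq_sym.
have surj y : exists x, closure_map x = y.
  pose P y := exists x, closure_map x = y.
  have PD y1 y2 : P y1 -> P y2 -> P (y1 + y2).
    by move=> [x1 <-] [x2 <-]; exists (x1 + x2); rewrite closure_mapD.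
  have PN y1 : P y1 -> P (- y1) by move=> [x1 <-]; exists (- x1); rewrite mapN.
  have P0 : P 0 by exists 0; apply: closure_map0.
  have Pz y1 z : P y1 -> P (y1 *~ z).
    move=> Py; have Pn m : P (y1 *+ m).
      by elim: m => [|m IHm]; rewrite ?mulr0n // mulrS; apply: PD.
    by case: z => m; rewrite ?NegzE ?mulrNz -?pmulrn; last apply: PN.
  have Porb A : P (orb A).
    have [m] := ubnP ((\sum_C depth C).+1 - depth A).
    elim: m A => // m IHm A ltm.
    have -> : orb A = closure_map (orb A)
        - \sum_(C | degen (natmx C) (natmx A) && (C != A)) orb C.
      apply/ffunP => C; rewrite closure_map_orb !ffunE sum_ffunE.
      have [->|nCA] := eqVneq C A.
        rewrite degen_refl big1 ?subr0 // => D /andP[_ DA].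
        by rewrite ffunE eq_sym (negPf DA).
      have [CA|CA] := boolP (degen _ _); last first.
        rewrite big1 ?subr0 // => D /andP[DA _]; rewrite ffunE.
        by case: eqP => // CD; rewrite CD DA in CA.
      rewrite (bigD1 C) ?CA //= ffunE eqxx big1 ?addr0 ?subrr //.
      by move=> D /andP[_ /negPf DC]; rewrite ffunE eq_sym DC.
    apply: (PD); first by exists (orb A).
    apply: PN; elim/big_ind: _ => [|y1 y2|C /andP[CA nCA]];
      [exact: P0 | exact: PD | apply: IHm].
    have := degen_depth CA nCA; have : (depth C <= \sum_C depth C)%N.
      by rewrite (bigD1 C) //= leq_addr.
    lia.
  rewrite [y]orb_expand; elim/big_ind: _ => [|y1 y2|A _];
    [exact: P0 | exact: PD | exact: Pz].
have [inv invK] := choice surj.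
by exists inv => // x; apply: inj; rewrite invK.
Qed.

End ClosureMap.

Section Isomorphism.
Variables (n r : nat) (n_gt0 : (0 < n)%N) (k : closedFieldType).
Variables (g : struct_consts n r {poly int}) (gP : is_schur_polynomials g).
Local Open Scope ring_scope.
Local Notation fmod := (free_mod n r int).
Implicit Types (x y : fmod) (A B C G : posmx n r).
Local Notation psi := (@closure_map n r).

Lemma generic_mul_tropical A B C : tropical (natmx A) (natmx B) (natmx C) ->
  generic_mul k (orb A) (orb B) = orb C.
Proof.
move=> ABC; rewrite /generic_mul bilin_mul_orb; apply/ffunP => D.
by rewrite !ffunE (open_orbit_tropical k ABC) (inj_eq (@Some_inj _)) eq_sym.
Qed.

Lemma generic_mul_none A B : ~~ composable (natmx A) (natmx B) ->
  generic_mul k (orb A) (orb B) = 0.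
Proof.
move=> nAB; rewrite /generic_mul bilin_mul_orb; apply/ffunP => D.
by rewrite !ffunE (open_orbit_none k nAB).
Qed.

(** The coefficient of e_C on both sides is 1 or 0, according to whether e_C
    lies in the closure of the product: on the left by the tropical formula,
    on the right by counting flags. *)
Lemma closure_map_generator G B : generator (natmx G) ->
  psi (generic_mul k (orb G) (orb B)) = schur0_mul g (psi (orb G)) (psi (orb B)).
Proof.
move=> genG; rewrite (closure_map_flat (generator_flat genG)).
rewrite /schur0_mul bilin_mul_orbl closure_map_orb.
apply/ffunP => C; rewrite [RHS]ffunE.
rewrite (eq_bigr (fun B' => if degen (natmx B') (natmx B)
    then (g G B' C).[0] else 0)); last first.
  by move=> B' _; rewrite ffunE; case: (degen _ _); rewrite ?mul1r ?mul0r.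
rewrite -big_mkcond (schur0_generator gP B C n_gt0 genG).
have [GB|nGB] := boolP (composable (natmx G) (natmx B)); last first.
  rewrite generic_mul_none // ffunE big1; last by move=> A _; rewrite ffunE.
  by case: belowP => // -[GB]; rewrite GB in nGB.
have [E GBE] := tropical_exists k GB.
rewrite (generic_mul_tropical GBE) closure_map_orb ffunE.
congr (_%:R); congr nat_of_bool; apply/idP/belowP => [|[_ rC cC le]].
  by move=> /(degen_tropical _ GBE)[].
by apply/(degen_tropical _ GBE).
Qed.

Lemma reduction_posmx A : generator (natmx A) \/ exists G B,
  [/\ generator (natmx G), offdiag (natmx B) < offdiag (natmx A)
    & tropical (natmx G) (natmx B) (natmx A)]%N.
Proof.
have totA : rk (natmx A) n n = r.
  rewrite rk_total -[RHS](eqP (posmxP A)).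
  by apply: eq_bigr => i _; apply: eq_bigr => j _; rewrite mxE.
have mk (M : 'M[nat]_n) : rk M n n = r -> exists B : posmx n r, natmx B = M.
  by rewrite rk_total; apply: natmx_surj.
case: (reduceP (natmx A)) => [d eA|i j d B ji dj|i j d B ji di].
- by left; apply: GenK eA.
- move=> lt td /[!totA] tB trop; right; have [_ Gc] := up_step_e ji dj.
  have [B' eB] := mk _ tB; have [|G eG] := mk (move_nat d i j).
    by rewrite -totA -td -(Gc ord_max).
  by exists G, B'; rewrite eG eB; split=> //; apply: GenE ji dj erefl.
move=> lt td /[!totA] tB trop; right; have [_ Gc] := down_step_f ji di.
have [B' eB] := mk _ tB; have [|G eG] := mk (move_nat d j i).
  by rewrite -totA -td -(Gc ord_max).
by exists G, B'; rewrite eG eB; split=> //; apply: GenF ji di erefl.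
Qed.

Lemma schur0_mulA x y z :
  schur0_mul g (schur0_mul g x y) z = schur0_mul g x (schur0_mul g y z).
Proof. by apply: bilin_mulA => A B D C; apply: schur0_assoc. Qed.

(** Write e_A as the product of a generator and an e_A' closer to the
    diagonal, and move the brackets in both algebras. *)
Lemma closure_map_mul_orb A B :
  psi (generic_mul k (orb A) (orb B)) = schur0_mul g (psi (orb A)) (psi (orb B)).
Proof.
have [m] := ubnP (offdiag (natmx A)); elim: m A => // m IHm A ltm.
case: (reduction_posmx A) => [|[G [A' [genG ltA' GA'A]]]].
  exact: closure_map_generator.
have psiA : psi (orb A) = schur0_mul g (psi (orb G)) (psi (orb A')).
  by rewrite -closure_map_generator // (generic_mul_tropical GA'A).
rewrite psiA schur0_mulA.
rewrite -IHm ?(leq_trans ltA') //.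
have cAB := tropical_composable (natmx B) GA'A.
have [A'B|nA'B] := boolP (composable (natmx A') (natmx B)); last first.
  rewrite !generic_mul_none // ?cAB // /schur0_mul.
  by rewrite closure_map0 bilin_mul0r.
have [D A'BD] := tropical_exists k A'B.
rewrite (generic_mul_tropical A'BD) -closure_map_generator //.
have GD : composable (natmx G) (natmx D).
  have [/composableP GA' _ _ _ _] := GA'A; have [_ rD _ _ _] := A'BD.
  by apply/composableP => a; rewrite GA' rD.
have [E GDE] := tropical_exists k GD.
rewrite (generic_mul_tropical GDE).
by rewrite (generic_mul_tropical (tropicalA GA'A A'BD GDE)).
Qed.

Lemma closure_map_mul : {morph psi : x y / generic_mul k x y >-> schur0_mul g x y}.
Proof.
move=> x y; move: x; apply: (additive_ext (phi := fun x => psi (generic_mul k x y))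
  (psi := fun x => schur0_mul g (psi x) (psi y))) => [x x'|x x'|A].
- by rewrite /generic_mul bilin_mulDl closure_mapD.
- by rewrite closure_mapD /schur0_mul bilin_mulDl.
move: y; apply: (additive_ext (phi := fun y => psi (generic_mul k (orb A) y))
  (psi := fun y => schur0_mul g (psi (orb A)) (psi y))) => [y y'|y y'|B].
- by rewrite /generic_mul bilin_mulDr closure_mapD.
- by rewrite closure_mapD /schur0_mul bilin_mulDr.
exact: closure_map_mul_orb.
Qed.

Lemma closure_map_one : psi (one_elt n r) = one_elt n r.
Proof.
rewrite /one_elt (big_morph psi (@closure_mapD n r) (@closure_map0 n r)).
apply: eq_bigr => d _; apply: closure_map_basis.
by case: (flat_k (fun i => d i)).
Qed.

Lemma closure_map_fixes : fixes_generators psi.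
Proof.
move=> d _; split=> [|i j ji]; first by apply: closure_map_basis; case: (flat_k d).
split=> [dj|di]; apply: closure_map_basis.
  by case: (up_step_e ji dj) => -[].
by case: (down_step_f ji di) => -[].
Qed.

Lemma fixes_generators_orb (phi : fmod -> fmod) G :
  fixes_generators phi -> generator (natmx G) -> phi (orb G) = orb G.
Proof.
move=> fix_phi genG; rewrite -basis_eltE.
have tot : rk (natmx G) n n = r.
  rewrite rk_total -[RHS](eqP (posmxP G)).
  by apply: eq_bigr => i _; apply: eq_bigr => j _; rewrite mxE.
have dsumT (d : 'I_n -> nat) : dsum d n = (\sum_i d i)%N.
  by apply: eq_bigl => i; rewrite ltn_ord.
case: genG => [d eG|i j d ji dj eG|i j d ji di eG]; rewrite eG in tot *.
- by apply: (fix_phi d _).1; rewrite -dsumT; move: tot; rewrite rk_diag minnn.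
- have [_ Gc] := up_step_e ji dj; have [|_ /(_ i j ji)[fe _]] := fix_phi d.
    by rewrite -dsumT -(Gc ord_max).
  exact: fe.
have [_ Gc] := down_step_f ji di; have [|_ /(_ i j ji)[_ ff]] := fix_phi d.
  by rewrite -dsumT -(Gc ord_max).
exact: ff.
Qed.

Lemma closure_map_unique (phi : fmod -> fmod) :
  is_alg_morphism (generic_mul k) (schur0_mul g) phi ->
  fixes_generators phi -> phi =1 psi.
Proof.
move=> [phiD phiM _] fix_phi; apply: additive_ext => // [|A].
  exact: closure_mapD.
have [m] := ubnP (offdiag (natmx A)); elim: m A => // m IHm A ltm.
case: (reduction_posmx A) => [genA|[G [B [genG ltB GBA]]]].
  by rewrite (fixes_generators_orb fix_phi genA) (closure_map_flat (generator_flat genA)).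
rewrite -(generic_mul_tropical GBA) phiM closure_map_mul.
rewrite (fixes_generators_orb fix_phi genG) (IHm B) ?(leq_trans ltB) //.
by rewrite (closure_map_flat (generator_flat genG)).
Qed.

End Isomorphism.

Theorem theorem7p3 (n r : nat) (n_gt0 : 0 < n) (r_gt0 : 0 < r)
    (k : closedFieldType) (g : struct_consts n r {poly int})
    (gP : is_schur_polynomials g) :
  exists psi : free_mod n r int -> free_mod n r int,
    [/\ is_alg_morphism (generic_mul k) (schur0_mul g) psi,
        fixes_generators psi,
        bijective psi
      & forall phi : free_mod n r int -> free_mod n r int,
          is_alg_morphism (generic_mul k) (schur0_mul g) phi ->
          fixes_generators phi -> phi =1 psi].
Proof.
exists (@closure_map n r); split.
- split; [exact: closure_mapD | exact: closure_map_mul | exact: closure_map_one].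
- exact: closure_map_fixes.
- exact: closure_map_bij.
exact: closure_map_unique.
Qed.
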